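(* Let $(M,Q,\omega)$ be an almost quaternionic skew-Hermitian manifold of dimension $4n$, $n>1$, with canonical connection $\nabla^{Q,\omega}$. Then $Q$ is quaternionic (i.e. $TM$ admits a torsion-free connection preserving $Q$) and $\omega$ is symplectic (i.e. $d\omega=0$) if and only if $(Q,\omega)$ is of type $\mathcal{X}_5$, that is, the torsion of $\nabla^{Q,\omega}$ is contained in the submodule $\mathcal{X}_5=[S^3_0\mathsf{E}\,\mathsf{H}]^*$.
   Context: $M$ is a connected smooth $4n$-manifold, $n>1$. An almost quaternionic structure $Q\subset \mathrm{End}(TM)$ is a rank 3 subbundle locally spanned by triples $\{J_1,J_2,J_3\}$ (admissible bases) of almost complex structures with $J_1J_2=-J_2J_1=J_3$. A scalar 2-form is a non-degenerate 2-form $\omega$ with $\omega(J_aX,J_aY)=\omega(X,Y)$ for all $a$ and all admissible bases; then $(Q,\omega)$ is an almost quaternionic skew-Hermitian structure (equivalently an $\mathsf{SO}^*(2n)\mathsf{Sp}(1)$-structure). Modules: $\mathsf{E}=\mathbb{C}^{2n}$, $\mathsf{H}=\mathbb{C}^2$ are the standard representations of $\mathsf{SO}^*(2n)$, $\mathsf{Sp}(1)$; $[\,\cdot\,]$ denotes the real form; $T_xM\cong[\mathsf{E}\mathsf{H}]$. $\mathsf{E}$ carries an invariant complex symmetric form; $S^k_0\mathsf{E}$ denotes trace-free symmetric tensors. $\mathsf{E}\otimes\Lambda^2\mathsf{E}=\Lambda^3\mathsf{E}\oplus\mathsf{K}\oplus\mathsf{E}$ (totally skew part; kernel $\mathsf{K}$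 of total antisymmetrization and trace; pure trace part), and similarly $\mathsf{E}\otimes S^2_0\mathsf{E}\cong S^3_0\mathsf{E}\oplus\mathsf{K}\oplus\mathsf{E}$. In the torsion space $\Lambda^2[\mathsf{EH}]^*\otimes[\mathsf{EH}]$ the $S^3\mathsf{H}$-isotypic part for $\mathsf{Sp}(1)$ is $[(\mathsf{E}\otimes\Lambda^2\mathsf{E})S^3\mathsf{H}]^*=[\mathsf{K}S^3\mathsf{H}]^*\oplus[\Lambda^3\mathsf{E}S^3\mathsf{H}]^*\oplus[\mathsf{E}S^3\mathsf{H}]^*$; the first two summands are $\mathcal{X}_1,\mathcal{X}_2$. Identify $[S^2_0\mathsf{E}]^*$ with the trace-free endomorphisms $B$ commuting with $Q$ for which $\omega(B\cdot,\cdot)$ is skew. With $\delta(A)(X,Y)=A(X,Y)-A(Y,X)$, the images under $\delta$ of the components $[\mathsf{KH}]^*,[\mathsf{EH}]^*,[S^3_0\mathsf{E}\mathsf{H}]^*$ of $[\mathsf{EH}]^*\otimes[S^2_0\mathsf{E}]^*$ are $\mathcal{X}_3,\mathcal{X}_4,\mathcal{X}_5$. Write $\mathcal{X}_{i_1\ldots i_j}=\mathcal{X}_{i_1}\oplus\cdots\oplus\mathcal{X}_{i_j}$. Connections: an Oproiu connection is a connection preserving $Q$ whose torsion $T^Q$ (the same for all of them) lies in $\mathcal{X}_{12}$. $\nabla^{Q,\mathrm{vol}}$ is the unique Oproiu connection preserving $\mathrm{vol}=\omega^{2n}$. The canonical connection is $\nabla^{Q,\omega}=\nabla^{Q,\mathrm{vol}}+A^{\mathrm{vol}}$,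 where $\omega(A^{\mathrm{vol}}(X,Y),Z)=\frac12(\nabla^{Q,\mathrm{vol}}_X\omega)(Y,Z)$; it preserves $Q$ and $\omega$, and its torsion takes values in $\mathcal{X}_{12345}$. $(Q,\omega)$ is of type $\mathcal{X}_{i_1\ldots i_j}$ if the torsion of $\nabla^{Q,\omega}$ takes values in $\mathcal{X}_{i_1\ldots i_j}$. *)

(* Defs.v *)
From HB Require Import structures.
From mathcomp Require Import all_boot all_order all_algebra all_fingroup.
From mathcomp Require Import all_classical all_reals all_analysis.
From mathcomp Require Import complex.

Set Implicit Arguments.
Unset Strict Implicit.
Unset Printing Implicit Defensive.

Import Order.TTheory GRing.Theory Num.Theory.
Import numFieldNormedType.Exports.

Local Open Scope classical_set_scope.
Local Open Scope ring_scope.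
Local Open Scope complex_scope.

(* C^oo on the open set A: all iterated directional derivatives exist and are
   differentiable at every point of A. *)
Definition smooth_on (R : realType) (V W : normedModType R)
    (A : set V) (f : V -> W) : Prop :=
  forall (vs : seq V) (p : V), A p ->
    differentiable (foldr (fun v (g : V -> W) => 'D_v g) f vs) p.

(* [fwd] and [inv] are total functions, meaningful on [dom] and [fwd @` dom]. *)
Record chart (R : realType) (T : topologicalType) (m : nat) := Chart {
  dom : set T;
  fwd :> T -> 'cV[R]_m;
  inv : 'cV[R]_m -> T;
  dom_open : open dom;
  img_open : open (fwd @` dom);
  fwdK : forall x, dom x -> inv (fwd x) = x;
  fwd_cont : {within dom, continuous fwd};
  inv_cont : {within fwd @` dom, continuous inv} }.

(* As in mathlib, each point comes with a preferred chart of the atlas.  The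
   tangent space at x is then 'cV[R]_m, a tangent vector being given by its
   coordinates in the preferred chart [chart_at x]. *)
Record manifold (R : realType) (m : nat) := Manifold {
  carrier :> topologicalType;
  carrier_hausdorff : hausdorff_space carrier;
  carrier_countable : @second_countable carrier;
  atlas : set (chart R carrier m);
  chart_at : carrier -> chart R carrier m;
  chart_at_atlas : forall x, atlas (chart_at x);
  chart_at_dom : forall x, dom (chart_at x) x;
  atlas_smooth : forall c c' : chart R carrier m, atlas c -> atlas c' ->
    smooth_on (c @` (dom c `&` dom c')) (c' \o inv c) }.

Section Tensors.
Variables (R : realType) (m : nat) (M : manifold R m).
Local Notation V := 'cV[R]_m.

Definition smooth_fun (U : set M) (f : M -> R) : Prop :=
  forall c : chart R M m, atlas c -> smooth_on (c @` (U `&` dom c)) (f \o inv c).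

(* The coordinates of the vector field X in the chart c: the tangent vector
   X y, given in the chart [chart_at y], is pushed forward by the transition
   map. *)
Definition chart_coord (c : chart R M m) (X : M -> V) (y : M) : V :=
  'D_(X y) (c \o inv (chart_at y)) (chart_at y y).

Definition smooth_field (U : set M) (X : M -> V) : Prop :=
  forall c : chart R M m, atlas c ->
    smooth_on (c @` (U `&` dom c)) (chart_coord c X \o inv c).

(* Local sections are represented by globally defined functions of which only
   the restriction to some neighbourhood of the point matters. *)
Definition fun_at (x : M) (f : M -> R) : Prop :=
  exists U : set M, [/\ open U, U x & smooth_fun U f].

Definition field_at (x : M) (X : M -> V) : Prop :=
  exists U : set M, [/\ open U, U x & smooth_field U X].

Definition bil (w : 'M[R]_m) (u v : V) : R := (u^T *m w *m v) 0 0.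

Definition smooth_end (U : set M) (J : M -> 'M[R]_m) : Prop :=
  forall x, U x -> forall X, field_at x X -> field_at x (fun y => J y *m X y).

Definition smooth_form (w : M -> 'M[R]_m) : Prop :=
  forall x X Y, field_at x X -> field_at x Y ->
    fun_at x (fun y => bil (w y) (X y) (Y y)).

Definition dirder (x : M) (v : V) (f : M -> R) : R :=
  'D_v (f \o inv (chart_at x)) (chart_at x x).

Definition bracket (X Y : M -> V) (x : M) : V :=
  let c := chart_at x in
  'D_(X x) (chart_coord c Y \o inv c) (c x) - 'D_(Y x) (chart_coord c X \o inv c) (c x).

Definition ext_der (w : M -> 'M[R]_m) (X Y Z : M -> V) (x : M) : R :=
  let W A B := fun y => bil (w y) (A y) (B y) in
  dirder x (X x) (W Y Z) + dirder x (Y x) (W Z X) + dirder x (Z x) (W X Y)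
  - bil (w x) (bracket X Y x) (Z x) - bil (w x) (bracket Y Z x) (X x)
  - bil (w x) (bracket Z X x) (Y x).

Definition closed_form (w : M -> 'M[R]_m) : Prop :=
  forall x X Y Z, field_at x X -> field_at x Y -> field_at x Z ->
    ext_der w X Y Z x = 0.

(* [D x v Y] is the covariant derivative at x along v of the local field Y. *)
Record is_connection (D : M -> V -> (M -> V) -> V) : Prop := IsConnection {
  conn_linear : forall x Y, field_at x Y -> forall (a : R) (u v : V),
    D x (a *: u + v) Y = a *: D x u Y + D x v Y;
  conn_add : forall x Y Z, field_at x Y -> field_at x Z -> forall v,
    D x v (fun y => Y y + Z y) = D x v Y + D x v Z;
  conn_leibniz : forall x f Y, fun_at x f -> field_at x Y -> forall v,
    D x v (fun y => f y *: Y y) = dirder x v f *: Y x + f x *: D x v Y;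
  conn_smooth : forall U X Y, open U -> smooth_field U X -> smooth_field U Y ->
    smooth_field U (fun y => D y (X y) Y) }.

Definition torsion (D : M -> V -> (M -> V) -> V) (X Y : M -> V) (x : M) : V :=
  D x (X x) Y - D x (Y x) X - bracket X Y x.

Definition torsion_free (D : M -> V -> (M -> V) -> V) : Prop :=
  forall x X Y, field_at x X -> field_at x Y -> torsion D X Y x = 0.

Definition nabla_form (D : M -> V -> (M -> V) -> V) (w : M -> 'M[R]_m)
    (x : M) (v : V) (Y Z : M -> V) : R :=
  dirder x v (fun y => bil (w y) (Y y) (Z y))
  - bil (w x) (D x v Y) (Z x) - bil (w x) (Y x) (D x v Z).

Definition admissible (Q : M -> set 'M[R]_m) (U : set M)
    (J1 J2 J3 : M -> 'M[R]_m) : Prop :=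
  [/\ smooth_end U J1, smooth_end U J2, smooth_end U J3 &
  forall x, U x ->
    [/\ J1 x *m J1 x = - 1%:M, J2 x *m J2 x = - 1%:M, J3 x *m J3 x = - 1%:M,
        J1 x *m J2 x = J3 x /\ J2 x *m J1 x = - J3 x &
        forall K, Q x K <->
          exists a b c : R, K = a *: J1 x + b *: J2 x + c *: J3 x]].

Definition almost_quaternionic (Q : M -> set 'M[R]_m) : Prop :=
  forall x, exists U, [/\ open U, U x &
    exists J1 J2 J3, admissible Q U J1 J2 J3].

Definition scalar_2form (Q : M -> set 'M[R]_m) (w : M -> 'M[R]_m) : Prop :=
  [/\ smooth_form w,
      forall x u v, bil (w x) u v = - bil (w x) v u,
      forall x, w x \in unitmx &
      forall U J1 J2 J3, open U -> admissible Q U J1 J2 J3 ->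
        forall x, U x -> forall J, J = J1 \/ J = J2 \/ J = J3 ->
        forall u v, bil (w x) (J x *m u) (J x *m v) = bil (w x) u v].

(* The covariant derivative of each local section J of Q is a section of Q;
   here (D_v J) Y = D_v (J Y) - J (D_v Y). *)
Definition preserves_Q (Q : M -> set 'M[R]_m)
    (D : M -> V -> (M -> V) -> V) : Prop :=
  forall U J, open U -> smooth_end U J -> (forall y, U y -> Q y (J y)) ->
  forall x, U x -> forall v, exists2 K, Q x K &
    forall Y, field_at x Y ->
      D x v (fun y => J y *m Y y) - J x *m D x v Y = K *m Y x.

Definition quaternionic (Q : M -> set 'M[R]_m) : Prop :=
  exists D, [/\ is_connection D, preserves_Q Q D & torsion_free D].

End Tensors.

Lemma pair_index_subproof (n : nat) (i : 'I_(2 * n)) (b : bool) :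
  (i.*2 + b < 4 * n)%N.
Proof.
have lt_i := ltn_ord i; have -> : (4 * n = (2 * n) + (2 * n))%N.
  by rewrite addnn -mul2n mulnA.
have : (i.+1.*2 <= 2 * n + 2 * n)%N by rewrite addnn leq_double.
by apply: leq_trans; rewrite doubleS; case: b; rewrite ?addn1 ?addn0.
Qed.

Definition pair_index (n : nat) (i : 'I_(2 * n)) (b : bool) : 'I_(4 * n) :=
  Ordinal (pair_index_subproof i b).

Section EH.
Variables (R : realType) (n : nat).
Local Notation V := 'cV[R]_(4 * n).
Local Notation C := R[i].

(* The 2n-th exterior power of w evaluated on Y_0, ..., Y_(4n-1). *)
Definition vol (w : 'M[R]_(4 * n)) (Y : 'I_(4 * n) -> V) : R :=
  2 ^- (2 * n) * \sum_(s : 'S_(4 * n)) (-1) ^+ s *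
    \prod_(i < 2 * n) bil w (Y (s (pair_index i false)))
                            (Y (s (pair_index i true))).

Definition preserves_vol (M : manifold R (4 * n)) (w : M -> 'M[R]_(4 * n))
    (D : M -> V -> (M -> V) -> V) : Prop :=
  forall x v (Y : 'I_(4 * n) -> M -> V), (forall i, field_at x (Y i)) ->
    dirder x v (fun y => vol (w y) (Y ^~ y)) =
    \sum_i vol (w x) (fun j => if j == i then D x v (Y j) else Y j x).

(* The symplectic form of H = C^2; the quaternionic structure of H is
   h |-> - epsH *m conj h, and sp1 its Lie algebra of symmetries sp(1). *)
Definition epsH : 'M[C]_2 := \matrix_(i, j) ((i < j)%:R - (j < i)%:R).

Definition conj_mx (p q : nat) (A : 'M[C]_(p, q)) : 'M[C]_(p, q) :=
  map_mx (@conjc R) A.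

Definition sp1 (s : 'M[C]_2) : Prop := \tr s = 0 /\ s^T = - conj_mx s.

(* An identification of a tangent space, with its quaternionic structure q and
   scalar 2-form w, with the real form [EH] of E (x) H.  Elements of E (x) H are
   2n x 2 matrices, e (x) h being e *m h^T.  The space E = C^(2n) carries the
   SO*(2n)-structure given by its complex symmetric form G and the
   quaternionic structure e |-> J *m conj e, compatible with G; all such pairs
   (G, J) are equivalent, so they need not be put in a normal form.  The
   quaternionic structure is sp(1) acting on H, and w is G (x) epsH. *)
Record EHframe (q : set 'M[R]_(4 * n)) (w : 'M[R]_(4 * n)) := EHFrame {
  frame :> V -> 'M[C]_(2 * n, 2);
  metric : 'M[C]_(2 * n);
  quat : 'M[C]_(2 * n);
  metric_sym : metric^T = metric;
  metric_unit : metric \in unitmx;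
  quat_sqr : quat *m conj_mx quat = - 1%:M;
  quat_metric : quat^T *m metric *m quat = conj_mx metric;
  frame_linear : forall (a : R) u v,
    frame (a *: u + v) = a%:C *: frame u + frame v;
  frame_inj : injective frame;
  frame_real : forall X : 'M[C]_(2 * n, 2),
    (exists v, frame v = X) <-> X = quat *m conj_mx X *m epsH;
  frame_quaternionic : forall K,
    q K <-> exists2 s, sp1 s & forall v, frame (K *m v) = frame v *m s^T;
  frame_form : forall u v, (bil w u v)%:C =
    \sum_a \sum_b \sum_A \sum_B
      metric a b * epsH A B * frame u a A * frame v b B }.

(* Covariant 3-tensors on E and the submodules Lambda^3 E, K of
   E (x) Lambda^2 E (with Lambda^2 in the first two slots) and S^3_0 E. *)
Definition tensor3 := 'I_(2 * n) -> 'I_(2 * n) -> 'I_(2 * n) -> C.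

Definition trace23 (G : 'M[C]_(2 * n)) (t : tensor3) (a : 'I_(2 * n)) : C :=
  \sum_b \sum_c invmx G b c * t a b c.

Definition Lambda3E (t : tensor3) : Prop :=
  (forall a b c, t b a c = - t a b c) /\ (forall a b c, t a c b = - t a b c).

Definition KE (G : 'M[C]_(2 * n)) (t : tensor3) : Prop :=
  [/\ forall a b c, t b a c = - t a b c,
      forall a b c, t a b c + t b c a + t c a b = 0 &
      forall a, trace23 G t a = 0].

Definition S30E (G : 'M[C]_(2 * n)) (t : tensor3) : Prop :=
  [/\ forall a b c, t b a c = t a b c, forall a b c, t a c b = t a b c &
      forall a, trace23 G t a = 0].

(* T lies in [P S^3 H]^* : the tensor w (T (u, v), z) has, in the frame,
   components t A B D a b c that are symmetric in A, B, D and in P as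
   tensors on E.  Since S^3 H occurs just once in the third tensor power of H,
   as the symmetric tensors, symmetry in A, B, D singles out the
   S^3 H-isotypic part. *)
Definition S3H_part (P : set tensor3) (q : set 'M[R]_(4 * n))
    (w : 'M[R]_(4 * n)) (F : EHframe q w) (T : V -> V -> V) : Prop :=
  exists t : 'I_2 -> 'I_2 -> 'I_2 -> tensor3,
  [/\ forall A B D, t B A D = t A B D,
      forall A B D, t A D B = t A B D,
      forall A B D, P (t A B D) &
      forall u v z, (bil w (T u v) z)%:C =
        \sum_A \sum_B \sum_D \sum_a \sum_b \sum_c
          t A B D a b c * F u a A * F v b B * F z c D].

Definition torsion_module := forall (q : set 'M[R]_(4 * n)) (w : 'M[R]_(4 * n)),
  EHframe q w -> set (V -> V -> V).

Definition X1 : torsion_module := fun q w F => S3H_part (KE (metric F)) F.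

Definition X2 : torsion_module := fun q w F => S3H_part Lambda3E F.

Definition X12 : torsion_module := fun q w F T =>
  exists T1 T2, [/\ X1 F T1, X2 F T2 & forall u v, T u v = T1 u v + T2 u v].

(* [S^2_0 E]^* as a space of endomorphisms. *)
Definition S20E (q : set 'M[R]_(4 * n)) (w B : 'M[R]_(4 * n)) : Prop :=
  [/\ \tr B = 0, forall K, q K -> K *m B = B *m K &
      forall u v, bil w (B *m u) v = - bil w (B *m v) u].

(* The component [S^3_0 E H]^* of [EH]^* (x) [S^2_0 E]^*. *)
Definition S30EH (q : set 'M[R]_(4 * n)) (w : 'M[R]_(4 * n)) (F : EHframe q w)
    (A : V -> 'M[R]_(4 * n)) : Prop :=
  (forall u, S20E q w (A u)) /\
  exists t : 'I_2 -> tensor3,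
    (forall D, S30E (metric F) (t D)) /\
    forall u v z, (bil w (A u *m v) z)%:C =
      \sum_A \sum_B \sum_D \sum_a \sum_b \sum_c
        t A a b c * epsH B D * F u a A * F v b B * F z c D.

Definition delta (A : V -> 'M[R]_(4 * n)) (u v : V) : V := A u *m v - A v *m u.

Definition X5 : torsion_module := fun q w F T =>
  exists2 A, S30EH F A & forall u v, T u v = delta A u v.

(* The torsion modules are invariant under SO*(2n)Sp(1), so that quantifying
   over all frames amounts to choosing one. *)
Definition torsion_in (X : torsion_module) (M : manifold R (4 * n))
    (Q : M -> set 'M[R]_(4 * n)) (w : M -> 'M[R]_(4 * n))
    (D : M -> V -> (M -> V) -> V) : Prop :=
  forall x (F : EHframe (Q x) (w x)), exists2 T, X (Q x) (w x) F T &
    forall Y Z, field_at x Y -> field_at x Z -> torsion D Y Z x = T (Y x) (Z x).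

Definition oproiu (M : manifold R (4 * n)) (Q : M -> set 'M[R]_(4 * n))
    (w : M -> 'M[R]_(4 * n)) (D : M -> V -> (M -> V) -> V) : Prop :=
  [/\ is_connection D, preserves_Q Q D & torsion_in X12 Q w D].

(* D = Dvol + Avol, where Dvol is the volume-preserving Oproiu connection and
   w (Avol (X, Y), Z) = 1/2 (Dvol_X w) (Y, Z). *)
Definition canonical_connection (M : manifold R (4 * n))
    (Q : M -> set 'M[R]_(4 * n)) (w : M -> 'M[R]_(4 * n))
    (D : M -> V -> (M -> V) -> V) : Prop :=
  is_connection D /\
  exists Dvol, [/\ oproiu Q w Dvol, preserves_vol w Dvol &
    forall x v Y Z, field_at x Y -> field_at x Z ->
      bil (w x) (D x v Y - Dvol x v Y) (Z x) = 2^-1 * nabla_form Dvol w x v Y Z].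

End EH.

(* Main.v *)
(** At a point, T M = [E H] and a frame turns tensors into components with
   E-indices a, b, c and H-indices A, B, D.  The difference of two connections
   preserving Q is a 1-form S with values in gl(n, H) + sp(1), and the torsions
   differ by delta S.  The S^3 H-part of delta S only sees the sp(1)-part of S,
   and has components g_bc s_a - g_ac s_b; being trace-free when it lies in X_12,
   it vanishes since (2n - 1) s_a = 0.  Hence Q is quaternionic iff the Oproiu
   torsion T^Q vanishes, and in both directions of the theorem T^Q = 0, so that
   the torsion of the canonical connection is delta A, with A = A^vol.

   As w is Q-Hermitian and Dvol preserves the volume, A takes values in S^2_0 E,
   that is, w (A u v, z) has components t_A,abc eps_BD with t symmetric and
   trace-free in b, c.  When T^Q = 0, dw = 0 is the vanishing of the cyclic sum of
   w (A u v, z), i.e. t_A,abc eps_BD + t_B,bca eps_DA + t_D,cab eps_AB = 0; since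
   dim H = 2, this holds iff t is totally symmetric, i.e. A lies in [S^3_0 E H]^*.
   Finally delta is injective on tensors with values in S^2_0 E, as a tensor that is
   symmetric in two arguments and skew in two others vanishes. *)

Require Import Defs.
From mathcomp Require Import all_boot all_order all_algebra all_fingroup.
From mathcomp Require Import all_classical all_reals all_analysis.
From mathcomp Require Import complex ring.

Set Implicit Arguments.
Unset Strict Implicit.
Unset Printing Implicit Defensive.

Import Order.TTheory GRing.Theory Num.Theory.
Import numFieldNormedType.Exports.
(* Restores [dom], which all_fingroup shadows. *)
Import Defs.

Local Open Scope classical_set_scope.
Local Open Scope ring_scope.
Local Open Scope complex_scope.

(** Components are taken in the complexification: a real-linear functional is extended
    complex-linearly and evaluated on the complex vectors that the frame sends to the basis of E (x)
    H. As dim H = 2, the representation theory of Sp(1) reduces to identities for [epsH] and case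
    analysis on an index.

    [torsion_in] quantifies over frames and would say nothing at a point without one, so the way
    back from X_5 needs the construction of a frame from an admissible basis. The frame also gives
    w^2n != 0, without which preservation of the volume would not control the trace of A^vol.

    On that way back, the tensor A' supplied by type X_5 is not known to be A^vol; only T^Q = delta
    (A' - A^vol) is. Since A' - A^vol commutes with Q, the argument that compares Dvol with a
    torsion-free connection applies once more and gives T^Q = 0, after which the injectivity of
    delta identifies A' with A^vol.

    Local sections are total functions of which only germs matter, so connections are shown to be
    local before they are compared. *)

Lemma linear_mulmxE (K : comNzRingType) (m p : nat) (f : 'cV[K]_m -> 'cV[K]_p) :
  (forall a u v, f (a *: u + v) = a *: f u + f v) ->
  exists B, forall v, f v = B *m v.
Proof.
move=> fl; exists (\matrix_(i, j) f (delta_mx j 0) i 0) => v.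
have f0 : f 0 = 0.
  by have := fl (-1) 0 0; rewrite scaler0 addr0 scaleN1r addNr.
have fD u1 u2 : f (u1 + u2) = f u1 + f u2 by rewrite -[u1 in LHS]scale1r fl scale1r.
have fZ a u : f (a *: u) = a *: f u by rewrite -[_ *: u]addr0 fl f0 addr0.
rewrite {1}[v]matrix_sum_delta (big_morph _ fD f0).
apply/colP => i; rewrite summxE !mxE; apply: eq_bigr => j _.
by rewrite big_ord1 fZ !mxE mulrC.
Qed.

Lemma ord2_ind (P : 'I_2 -> Prop) : P 0 -> P 1 -> forall i, P i.
Proof.
by move=> P0 P1 [[|[|//]] hi]; [move: P0 | move: P1]; congr P; apply: val_inj.
Qed.

Lemma big_kron (K : pzSemiRingType) (I : finType) (f : I -> K) (j : I) :
  \sum_i f i * (i == j)%:R = f j.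
Proof.
rewrite (bigD1 j) //= eqxx mulr1 big1 ?addr0 // => i /negPf ->.
by rewrite mulr0.
Qed.

Lemma double_pred_neq0 n : (0 < n)%N -> (2 * n).-1 != 0%N.
Proof. by case: n => // n _; rewrite mulnS. Qed.

Section BilinearForm.
Variables (R : realType) (m : nat) (w : 'M[R]_m).
Implicit Types u v z : 'cV[R]_m.

Lemma bilDl u v z : bil w (u + v) z = bil w u z + bil w v z.
Proof. by rewrite /bil linearD !mulmxDl mxE. Qed.

Lemma bilDr u v z : bil w u (v + z) = bil w u v + bil w u z.
Proof. by rewrite /bil mulmxDr mxE. Qed.

Lemma bilZl a u z : bil w (a *: u) z = a * bil w u z.
Proof. by rewrite /bil linearZ -!scalemxAl mxE. Qed.

Lemma bilZr a u z : bil w u (a *: z) = a * bil w u z.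
Proof. by rewrite /bil -scalemxAr mxE. Qed.

Lemma bilNl u z : bil w (- u) z = - bil w u z.
Proof. by rewrite -scaleN1r bilZl mulN1r. Qed.

Lemma bilNr u z : bil w u (- z) = - bil w u z.
Proof. by rewrite -scaleN1r bilZr mulN1r. Qed.

Lemma bilBl u v z : bil w (u - v) z = bil w u z - bil w v z.
Proof. by rewrite bilDl bilNl. Qed.

End BilinearForm.

(** * Components of tensors in a frame *)

Section Complexification.
Variables (R : realType) (n : nat).
Local Notation V := 'cV[R]_(4 * n).
Local Notation C := R[i].
Variables (q : set 'M[R]_(4 * n)) (w : 'M[R]_(4 * n)) (F : EHframe q w).

(** These are the restrictions to the real form of the complex-linear functionals on E (x) H. *)
Definition rlin (f : V -> C) : Prop :=
  forall (a : R) u v, f (a *: u + v) = a%:C * f u + f v.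

Lemma rlin0 f : rlin f -> f 0 = 0.
Proof.
move=> fl; have := fl 0 0 0; rewrite scale0r add0r mul0r add0r => h.
by have := fl 1 0 0; rewrite scale1r addr0 mul1r -{1}[f 0]addr0 => /addrI.
Qed.

Lemma rlinD f u v : rlin f -> f (u + v) = f u + f v.
Proof. by move=> fl; rewrite -[u in LHS]scale1r fl mul1r. Qed.

Lemma rlinZ f a v : rlin f -> f (a *: v) = a%:C * f v.
Proof. by move=> fl; rewrite -[_ *: _]addr0 fl rlin0 // addr0. Qed.

Lemma rlin_sum f (I : finType) (g : I -> V) :
  rlin f -> f (\sum_i g i) = \sum_i f (g i).
Proof.
move=> fl; rewrite (big_morph f (id1 := 0) (op1 := +%R)) ?rlin0 //.
by move=> u v; rewrite rlinD.
Qed.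

Lemma frameD u v : F (u + v) = F u + F v.
Proof. by rewrite -[u in LHS]scale1r (frame_linear F) scale1r. Qed.

Lemma frame0 : F 0 = 0.
Proof. by apply: (addrI (F 0)); rewrite -frameD !addr0. Qed.

Lemma frameZ a v : F (a *: v) = a%:C *: F v.
Proof. by rewrite -[_ *: _]addr0 (frame_linear F) frame0 addr0. Qed.

Lemma frameN v : F (- v) = - F v.
Proof. by rewrite -scaleN1r frameZ rmorphN1 scaleN1r. Qed.

Lemma rlin_frame a A : rlin (fun v => F v a A).
Proof. by move=> r u v; rewrite (frame_linear F) !mxE. Qed.

(* The conjugation of the complexification E (x) H with real form [EH]. *)
Definition real_structure (X : 'M[C]_(2 * n, 2)) : 'M[C]_(2 * n, 2) :=
  quat F *m conj_mx X *m epsH R.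

Lemma epsH_sqr : epsH R *m epsH R = - 1%:M.
Proof.
apply/matrixP => i j; rewrite !mxE !big_ord_recl big_ord0 !mxE /=.
by elim/ord2_ind: i; elim/ord2_ind: j => /=; ring.
Qed.

Lemma conjc_i : ('i%C : C)^*%C = - 'i%C.
Proof. by apply/eqP; rewrite eq_complex /= oppr0 !eqxx. Qed.

Lemma conj_mxM p r s (A : 'M[C]_(p, r)) (B : 'M[C]_(r, s)) :
  conj_mx (A *m B) = conj_mx A *m conj_mx B.
Proof. exact: map_mxM. Qed.

Lemma conj_mxD p r (A B : 'M[C]_(p, r)) : conj_mx (A + B) = conj_mx A + conj_mx B.
Proof. exact: map_mxD. Qed.

Lemma conj_mxZ p r (c : C) (A : 'M[C]_(p, r)) :
  conj_mx (c *: A) = c^*%C *: conj_mx A.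
Proof. exact: map_mxZ. Qed.

Lemma conj_mxK p r (A : 'M[C]_(p, r)) : conj_mx (conj_mx A) = A.
Proof. by apply/matrixP => i j; rewrite !mxE conjcK. Qed.

Lemma conj_epsH : conj_mx (epsH R) = epsH R.
Proof.
by apply/matrixP => i j; rewrite !mxE rmorphB !rmorph_nat.
Qed.

Lemma real_structureK X : real_structure (real_structure X) = X.
Proof.
rewrite /real_structure !conj_mxM conj_epsH conj_mxK !mulmxA (quat_sqr F).
by rewrite -!mulmxA epsH_sqr mulmxN !mulNmx mul1mx mulmx1 opprK.
Qed.

Lemma real_structureD X Y :
  real_structure (X + Y) = real_structure X + real_structure Y.
Proof. by rewrite /real_structure conj_mxD mulmxDr mulmxDl. Qed.

Lemma real_structureZ c X : real_structure (c *: X) = c^*%C *: real_structure X.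
Proof. by rewrite /real_structure conj_mxZ -scalemxAr -scalemxAl. Qed.

Lemma frame_fixed v : real_structure (F v) = F v.
Proof. by symmetry; apply/(frame_real F); exists v. Qed.

(** The real part (X + s X)/2 and the imaginary part (X - s X)/(2i) for the antilinear involution s
    = [real_structure] are fixed by s, hence in the image of the frame. *)
Lemma frame_complexE (X : 'M[C]_(2 * n, 2)) :
  exists p : V * V, F p.1 + 'i%C *: F p.2 = X.
Proof.
pose h : C := 2^-1.
have hE : h^*%C = h by rewrite /h conjc_inv rmorph_nat.
pose Y := h *: (X + real_structure X).
pose Z := (- 'i%C * h) *: (X - real_structure X).
have [y Ey] : exists v, F v = Y.
  apply/(frame_real F); rewrite -/(real_structure Y) real_structureZ hE.
  by rewrite real_structureD real_structureK addrC.
have [z Ez] : exists v, F v = Z.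
  apply/(frame_real F); rewrite -/(real_structure Z) real_structureZ.
  have -> : (- 'i%C * h)^*%C = 'i%C * h.
    transitivity ((- 'i%C : C)^*%C * h^*%C); first exact: rmorphM.
    by congr (_ * _) => //; apply/eqP; rewrite eq_complex /= opprK oppr0 !eqxx.
  rewrite real_structureD -scaleN1r real_structureZ real_structureK.
  have -> : (-1 : C)^*%C = -1 by rewrite rmorphN1.
  by rewrite /Z scaleN1r mulNr scaleNr -scalerN opprB [_ + - X]addrC.
exists (y, z) => /=; rewrite Ey Ez scalerA.
have -> : 'i%C * (- 'i%C * h) = h by rewrite mulrA mulrN -expr2 sqr_i opprK mul1r.
rewrite -scalerDr addrACA subrr addr0 -[X in X + X]scale1r -scalerDl scalerA.
rewrite -mulr2n -mulr_natr.
by rewrite mul1r /h mulVf ?scale1r // pnatr_eq0.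
Qed.

(* The vector p.1 + i p.2 of the complexified tangent space corresponding to the
   element (a, A) of the standard basis of E (x) H. *)
Definition dual_pair (a : 'I_(2 * n)) (A : 'I_2) : V * V :=
  sval (cid (frame_complexE (delta_mx a A))).

Lemma dual_pairE a A :
  F (dual_pair a A).1 + 'i%C *: F (dual_pair a A).2 = delta_mx a A.
Proof. by rewrite /dual_pair; case: cid. Qed.

(** The complex-linear extension of [f], evaluated at the basis vector of E (x) H with indices a,
    A. *)
Definition cpl (f : V -> C) a A : C :=
  f (dual_pair a A).1 + 'i%C * f (dual_pair a A).2.

Lemma eq_cpl f g a A : f =1 g -> cpl f a A = cpl g a A.
Proof. by move=> fg; rewrite /cpl !fg. Qed.

Lemma cplD f g a A : cpl (fun v => f v + g v) a A = cpl f a A + cpl g a A.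
Proof. by rewrite /cpl; ring. Qed.

Lemma cplN f a A : cpl (fun v => - f v) a A = - cpl f a A.
Proof. by rewrite /cpl; ring. Qed.

Lemma cplMl c f a A : cpl (fun v => c * f v) a A = c * cpl f a A.
Proof. by rewrite /cpl; ring. Qed.

Lemma cplMr c f a A : cpl (fun v => f v * c) a A = cpl f a A * c.
Proof. by rewrite /cpl; ring. Qed.

Lemma cpl_cst0 a A : cpl (fun _ => 0) a A = 0.
Proof. by rewrite /cpl mulr0 addr0. Qed.

Lemma cpl_sum (I : finType) (f : I -> V -> C) a A :
  cpl (fun v => \sum_i f i v) a A = \sum_i cpl (f i) a A.
Proof. by rewrite /cpl mulr_sumr -big_split. Qed.

Lemma cpl_exchange (f : V -> V -> C) a A b B :
  cpl (fun u => cpl (f u) b B) a A = cpl (fun v => cpl (f ^~ v) a A) b B.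
Proof. by rewrite /cpl; ring. Qed.

Lemma cpl_frame b B a A :
  cpl (fun v => F v b B) a A = (b == a)%:R * (B == A)%:R.
Proof.
have := congr1 (fun X : 'M[C]_(2 * n, 2) => X b B) (dual_pairE a A).
by rewrite !mxE -natrM mulnb.
Qed.

Lemma cplK f : rlin f -> forall v, f v = \sum_a \sum_A cpl f a A * F v a A.
Proof.
move=> fl v.
pose x a A := complex.Re (F v a A); pose y a A := complex.Im (F v a A).
pose p a A := (dual_pair a A).1; pose r a A := (dual_pair a A).2.
have vE a A : F v a A = (x a A)%:C + 'i%C * (y a A)%:C by exact: complexE.
(* [v1] and [v2] are the real and imaginary parts of the sum of the [F v a A] times the complex
   vectors p + i r; the aim is [v1 = v] and [v2 = 0]. *)
pose v1 := \sum_a \sum_A (x a A *: p a A - y a A *: r a A).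
pose v2 := \sum_a \sum_A (y a A *: p a A + x a A *: r a A).
have key g : rlin g ->
    g v1 + 'i%C * g v2 = \sum_a \sum_A F v a A * (g (p a A) + 'i%C * g (r a A)).
  move=> gl; rewrite !rlin_sum // mulr_sumr -big_split; apply: eq_bigr => a _.
  rewrite !rlin_sum // mulr_sumr -big_split; apply: eq_bigr => A _ /=.
  rewrite vE -scaleNr !rlinD // !rlinZ // rmorphN /=.
  have i2 : 'i%C * 'i%C = -1 :> C by rewrite -expr2 sqr_i.
  have -> : ((x a A)%:C + 'i%C * (y a A)%:C) * (g (p a A) + 'i%C * g (r a A)) =
    (x a A)%:C * g (p a A) + ('i%C * 'i%C) * (y a A)%:C * g (r a A) +
    'i%C * ((y a A)%:C * g (p a A) + (x a A)%:C * g (r a A)) by ring.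
  by rewrite i2 mulN1r.
have Fv : F v1 + 'i%C *: F v2 = F v.
  apply/matrixP => b B; have := key _ (rlin_frame b B); rewrite !mxE => ->.
  rewrite -[RHS](big_kron (fun a => F v a B) b); apply: eq_bigr => a _.
  rewrite -[F v a B](big_kron (fun A => F v a A) B) mulr_suml.
  apply: eq_bigr => A _; rewrite -mulrA; congr (_ * _).
  have := cpl_frame b B a A; rewrite /cpl => ->.
  by rewrite mulrC (eq_sym b) (eq_sym B).
have {}Fv : F (v - v1) = 'i%C *: F v2 by rewrite frameD frameN -Fv addrAC subrr add0r.
(* F (v - v1) and F v2 are both fixed by the antilinear real structure, while the first is i times
   the second. *)
have v20 : F v2 = 0.
  have := congr1 real_structure Fv; rewrite real_structureZ !frame_fixed Fv conjc_i.
  rewrite scaleNr => /eqP; rewrite -addr_eq0 -scalerDl scaler_eq0 => /orP[|/eqP //].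
  rewrite -mulr2n mulrn_eq0 /= eq_complex /= oner_eq0 andbF //.
have {}v20 : v2 = 0 by apply: (@frame_inj _ _ _ _ F); rewrite v20 frame0.
have v1E : v = v1.
  apply/eqP; rewrite -subr_eq0; apply/eqP/(@frame_inj _ _ _ _ F).
  by rewrite Fv v20 frame0 scaler0.
rewrite {1}v1E; have := key _ fl; rewrite v20 rlin0 // mulr0 addr0 => ->.
by apply: eq_bigr => a _; apply: eq_bigr => A _; rewrite mulrC.
Qed.

Lemma cpl_eq0 f : rlin f -> (forall a A, cpl f a A = 0) -> forall v, f v = 0.
Proof.
move=> fl f0 v; rewrite cplK //.
by rewrite big1 // => a _; rewrite big1 // => A _; rewrite f0 mul0r.
Qed.

Lemma cpl_coef (c : 'I_(2 * n) -> 'I_2 -> C) a A :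
  cpl (fun v => \sum_b \sum_B c b B * F v b B) a A = c a A.
Proof.
rewrite cpl_sum -[RHS](big_kron (fun b => c b A) a); apply: eq_bigr => b _.
rewrite cpl_sum -[c b A](big_kron (fun B => c b B) A) mulr_suml.
by apply: eq_bigr => B _; rewrite cplMl cpl_frame mulrAC mulrA.
Qed.

Definition cpl2 (b : V -> V -> C) a A c D := cpl (fun v => cpl (b v) c D) a A.

Definition cpl3 (T : V -> V -> V -> C) a A b B c D :=
  cpl (fun u => cpl2 (T u) b B c D) a A.

Lemma eq_cpl2 f g a A b B : f =2 g -> cpl2 f a A b B = cpl2 g a A b B.
Proof. by move=> fg; apply: eq_cpl => u; apply: eq_cpl. Qed.

Lemma eq_cpl3 f g a A b B c D : (forall u v z, f u v z = g u v z) ->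
  cpl3 f a A b B c D = cpl3 g a A b B c D.
Proof. by move=> fg; apply: eq_cpl => u; apply: eq_cpl2. Qed.

Lemma cpl3D f g a A b B c D : cpl3 (fun u v z => f u v z + g u v z) a A b B c D =
  cpl3 f a A b B c D + cpl3 g a A b B c D.
Proof. by rewrite /cpl3 /cpl2 /cpl; ring. Qed.

Lemma cpl3B f g a A b B c D : cpl3 (fun u v z => f u v z - g u v z) a A b B c D =
  cpl3 f a A b B c D - cpl3 g a A b B c D.
Proof. by rewrite /cpl3 /cpl2 /cpl; ring. Qed.

Lemma cpl3_flip f a A b B c D :
  cpl3 (fun u v => f v u) a A b B c D = cpl3 f b B a A c D.
Proof. exact: cpl_exchange. Qed.

Lemma eq_cpl3_sum (I : finType) (f : I -> V -> V -> V -> C) g a A b B c D :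
  (forall i, cpl3 (f i) a A b B c D = g i) ->
  cpl3 (fun u v z => \sum_i f i u v z) a A b B c D = \sum_i g i.
Proof.
move=> fg; under [RHS]eq_bigr do rewrite -fg.
rewrite /cpl3 /cpl2 -cpl_sum; apply: eq_cpl => u; rewrite -cpl_sum.
by apply: eq_cpl => v; rewrite -cpl_sum.
Qed.

Lemma sum_only1 (I : finType) (f : I -> C) j :
  (forall i, (i == j) = false -> f i = 0) -> \sum_i f i = f j.
Proof. by move=> f0; rewrite (bigD1 j) //= big1 ?addr0 // => i /negPf/f0. Qed.

Lemma cpl3_coef (t : 'I_2 -> 'I_2 -> 'I_2 -> tensor3 R n) a A b B c D :
  cpl3 (fun u v z => \sum_A \sum_B \sum_D \sum_a \sum_b \sum_c
          t A B D a b c * F u a A * F v b B * F z c D) a A b B c D =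
  t A B D a b c.
Proof.
have E A' B' D' a' b' c' : cpl3 (fun u v z =>
    t A' B' D' a' b' c' * F u a' A' * F v b' B' * F z c' D') a A b B c D =
    t A' B' D' a' b' c' * ((a' == a)%:R * (A' == A)%:R) *
    ((b' == b)%:R * (B' == B)%:R) * ((c' == c)%:R * (D' == D)%:R).
  by rewrite -!cpl_frame /cpl3 /cpl2 /cpl; ring.
apply: etrans; first by do 6!(apply: eq_cpl3_sum => ?); exact: E.
have z0 x : x = false -> (x%:R : C) = 0 by move->.
rewrite (sum_only1 (j := A)) => [|i /z0 i0]; last first.
  by do ?(apply: big1 => ? _); rewrite i0 ?(mul0r, mulr0).
rewrite (sum_only1 (j := B)) => [|i /z0 i0]; last first.
  by do ?(apply: big1 => ? _); rewrite i0 ?(mul0r, mulr0).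
rewrite (sum_only1 (j := D)) => [|i /z0 i0]; last first.
  by do ?(apply: big1 => ? _); rewrite i0 ?(mul0r, mulr0).
rewrite (sum_only1 (j := a)) => [|i /z0 i0]; last first.
  by do ?(apply: big1 => ? _); rewrite i0 ?(mul0r, mulr0).
rewrite (sum_only1 (j := b)) => [|i /z0 i0]; last first.
  by do ?(apply: big1 => ? _); rewrite i0 ?(mul0r, mulr0).
rewrite (sum_only1 (j := c)) => [|i /z0 i0]; last first.
  by do ?(apply: big1 => ? _); rewrite i0 ?(mul0r, mulr0).
by rewrite !eqxx !mulr1.
Qed.

Definition qinv (b : V -> V -> C) : Prop :=
  forall K, q K -> forall u v, b (K *m u) v + b u (K *m v) = 0.

(** Right multiplication by [s^T] commutes with the real structure, because s is skew-Hermitian and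
    s eps = - eps s^T; so it preserves the real form and comes from an endomorphism of the tangent
    space. *)
Lemma sp1_realized s : sp1 s ->
  exists2 K, q K & forall v, F (K *m v) = F v *m s^T.
Proof.
move=> s1; have [s_tr s_herm] := s1.
have sE : s *m epsH R = - epsH R *m s^T.
  have s11 : s 1 1 = - s 0 0.
    by move: s_tr; rewrite /mxtrace !big_ord_recl big_ord0 addr0 => /eqP;
       rewrite addrC addr_eq0 => /eqP <-; congr (s _ _); apply: val_inj.
  apply/matrixP => i j; rewrite !mxE !big_ord_recl !big_ord0 !mxE /=.
  have -> : lift ord0 ord0 = 1 :> 'I_2 by apply: val_inj.
  by elim/ord2_ind: i; elim/ord2_ind: j => /=; rewrite ?s11; ring.
have ex v : exists u, F u = F v *m s^T.
  apply/(frame_real F); rewrite -{1}frame_fixed /real_structure conj_mxM.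
  have -> : conj_mx s^T = - s.
    have /(congr1 (@conj_mx _ _ _)) := s_herm.
    by rewrite /conj_mx map_mxN /= => ->; rewrite -/(conj_mx _) conj_mxK.
  rewrite mulmxN -[in RHS]mulmxA mulNmx -[in RHS]mulmxA sE !mulNmx !mulmxN opprK.
  by rewrite !mulmxA.
have [f fE] := choice ex.
have fl a u v : f (a *: u + v) = a *: f u + f v.
  apply: (@frame_inj _ _ _ _ F).
  by rewrite fE !(frame_linear F) !fE mulmxDl -scalemxAl.
have [K KE] := linear_mulmxE fl.
have FK v : F (K *m v) = F v *m s^T by rewrite -KE fE.
by exists K => //; apply/(frame_quaternionic F); exists s.
Qed.

Lemma cpl_mulmx f K s a A : rlin f -> (forall v, F (K *m v) = F v *m s^T) ->
  cpl (fun v => f (K *m v)) a A = \sum_B cpl f a B * s B A.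
Proof.
move=> fl FK; rewrite -[RHS](cpl_coef (fun a A => \sum_B cpl f a B * s B A)).
apply: eq_cpl => v; rewrite cplK //; apply: eq_bigr => b _.
under eq_bigr do rewrite FK mxE mulr_sumr.
rewrite exchange_big; apply: eq_bigr => B _; rewrite mulr_suml.
by apply: eq_bigr => B' _; rewrite !mxE mulrAC mulrA.
Qed.

(** Invariance under diag(i, -i) kills the components with B = D, and invariance under a real
    rotation generator makes the other two opposite: on H, only multiples of [epsH] are invariant
    under sp(1). *)
Lemma qinv_cpl2 b : (forall v, rlin (b v)) -> (forall v, rlin (b ^~ v)) ->
  qinv b -> forall a B c D, cpl2 b a B c D = cpl2 b a 0 c 1 * epsH R B D.
Proof.
move=> br bl binv a B0 c D0.
have blc D' c' : rlin (fun v => cpl (b v) c' D').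
  by move=> r u v; rewrite /cpl !bl; ring.
have E s : sp1 s -> forall B D, \sum_B' cpl2 b a B' c D * s B' B +
    \sum_D' cpl2 b a B c D' * s D' D = 0.
  move=> /sp1_realized [K qK FK] B D.
  transitivity (cpl2 (fun u v => b (K *m u) v + b u (K *m v)) a B c D).
    rewrite -(cpl_mulmx (f := fun u => cpl (b u) c D) a B (blc D c) FK).
    transitivity (cpl2 (fun u v => b (K *m u) v) a B c D +
                  cpl2 (fun u v => b u (K *m v)) a B c D); last first.
      by rewrite /cpl2 /cpl; ring.
    congr (_ + _); symmetry.
    rewrite -[RHS](eq_bigr _ (fun D' _ => cplMr (s D' D) _ a B)) -cpl_sum.
    by apply: eq_cpl => u; rewrite (cpl_mulmx _ _ _ FK).
  by rewrite (eq_cpl2 (g := fun _ _ => 0)) /cpl2 /cpl ?(mulr0, addr0) // => u v; apply: binv.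
have s1 : sp1 (\matrix_(i, j) Complex 0 ((i == j)%:R * (-1) ^+ i) : 'M[C]_2).
  split.
    rewrite /mxtrace !big_ord_recl big_ord0 !mxE; apply/eqP.
    by rewrite eq_complex /= !addr0 mulr1 expr1 mul1r subrr !eqxx.
  apply/matrixP => i j; rewrite !mxE; apply/eqP; rewrite eq_complex /= oppr0 opprK.
  by rewrite eqxx [j == i]eq_sym /=; case: (i =P j) => [->|_]; rewrite ?mul0r.
have s2 : sp1 (\matrix_(i, j) ((j < i)%:R - (i < j)%:R) : 'M[C]_2).
  split.
    by rewrite /mxtrace !big_ord_recl big_ord0 !mxE /=; ring.
  apply/matrixP => i j; rewrite !mxE.
  by rewrite rmorphB !rmorph_nat opprB.
have i0 : ('i%C : C) != 0 by rewrite eq_complex /= oner_eq0 andbF.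
have l1 : lift ord0 ord0 = 1 :> 'I_2 by apply: val_inj.
have kN : Complex 0 (-1) = - 'i%C :> C.
  by apply/eqP; rewrite eq_complex /= oppr0 !eqxx.
have k0 : Complex 0 0 = 0 :> C by [].
have two_inj (x : C) : x * 'i%C + x * 'i%C = 0 -> x = 0.
  rewrite -mulrDl -mulr2n => /eqP.
  by rewrite mulf_eq0 (negPf i0) orbF mulrn_eq0 /= => /eqP.
have := E _ s1 0 0; have := E _ s1 1 1; have := E _ s2 0 0; have := E _ s2 0 1.
have o0 : ord0 = 0 :> 'I_2 by apply: val_inj.
rewrite !big_ord_recl !big_ord0 !mxE l1 !o0 /= modn_small // expr0 expr1.
rewrite !(mul0r, mul1r, k0, kN, mulr0, addr0, add0r, subrr, subr0, sub0r, mulr1, oppr0).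
move=> e1 e2 /eqP; rewrite !mulrN -opprD oppr_eq0 => /eqP/two_inj e3 /two_inj e4.
elim/ord2_ind: B0; elim/ord2_ind: D0; rewrite /= ?subrr ?mulr0 ?subr0 ?mulr1 //.
by rewrite sub0r mulrN1; apply/eqP; rewrite -addr_eq0; apply/eqP.
Qed.

Definition cbil (u v : V) : C := (bil w u v)%:C.

Lemma rlin_cbil u : rlin (cbil u).
Proof. by move=> a v z; rewrite /cbil bilDr bilZr rmorphD rmorphM. Qed.

Lemma rlin_cbil_mulmxl K u : rlin (fun v => cbil (K *m v) u).
Proof.
by move=> a v z; rewrite /cbil mulmxDr -scalemxAr bilDl bilZl rmorphD rmorphM.
Qed.

Lemma cpl2_cbil b B c D : cpl2 cbil b B c D = metric F b c * epsH R B D.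
Proof.
rewrite -[RHS](cpl_coef (fun b B => metric F b c * epsH R B D)).
apply: eq_cpl => u.
rewrite -[RHS](cpl_coef (fun c D => \sum_b \sum_B metric F b c * epsH R B D * F u b B)).
apply: eq_cpl => v; rewrite /cbil (frame_form F) exchange_big.
apply: eq_bigr => c' _; under eq_bigr do rewrite exchange_big.
rewrite exchange_big; apply: eq_bigr => D' _.
rewrite mulr_suml; apply: eq_bigr => b' _; rewrite mulr_suml.
by apply: eq_bigr => B' _.
Qed.

Lemma cpl2_cbil_sp1 K s b B c D : (forall v, F (K *m v) = F v *m s^T) ->
  cpl2 (fun v z => cbil (K *m v) z) b B c D =
  metric F b c * \sum_B' s B' B * epsH R B' D.
Proof.
move=> FK; rewrite /cpl2.
rewrite (cpl_mulmx (f := fun v => cpl (cbil v) c D) b B _ FK); last first.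
  by move=> a u v; rewrite /cpl /cbil !bilDl !bilZl !rmorphD !rmorphM /=; ring.
rewrite mulr_sumr; apply: eq_bigr => B' _.
by rewrite [X in X * _]cpl2_cbil; ring.
Qed.

(** This is sl(2, C) = S^2 H: a trace-free matrix becomes symmetric when its upper index is lowered
    by [epsH]. *)
Lemma sp1_eps_sym (s : 'M[C]_2) B D : sp1 s ->
  \sum_B' s B' B * epsH R B' D = \sum_B' s B' D * epsH R B' B.
Proof.
have l1 : lift ord0 ord0 = 1 :> 'I_2 by apply: val_inj.
have o0 : ord0 = 0 :> 'I_2 by apply: val_inj.
case; rewrite /mxtrace !big_ord_recl !big_ord0 l1 o0 addr0 => /eqP.
rewrite addr_eq0 => /eqP s00 _; rewrite !mxE.
by elim/ord2_ind: B; elim/ord2_ind: D; rewrite /= ?s00; ring.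
Qed.

Lemma metricC a b : metric F a b = metric F b a.
Proof. by rewrite -[in LHS](Defs.metric_sym F) mxE. Qed.

Lemma trace_sum_metric (c : C) :
  \sum_b \sum_d invmx (metric F) b d * (metric F b d * c) = (2 * n)%:R * c.
Proof.
transitivity (\tr (invmx (metric F) *m metric F) * c); last first.
  by rewrite mulVmx ?metric_unit // mxtrace1.
rewrite /mxtrace mulr_suml; apply: eq_bigr => b _; rewrite !mxE mulr_suml.
apply: eq_bigr => d _; rewrite mulrA; congr (_ * _ * _).
exact: metricC.
Qed.

Lemma trace_metric_vec (s : 'I_(2 * n) -> C) a :
  \sum_b \sum_d invmx (metric F) b d * (metric F a d * s b) = s a.
Proof.
rewrite -[RHS](big_kron s a); apply: eq_bigr => b _.
have -> : (b == a)%:R = (invmx (metric F) *m metric F) b a.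
  by rewrite mulVmx ?metric_unit // mxE.
rewrite mxE mulr_sumr; apply: eq_bigr => d _.
by rewrite (metricC a d); ring.
Qed.

(** A skew pair of indices is contracted with a symmetric matrix. *)
Lemma trace23_Lambda3E t a : Lambda3E t -> trace23 (metric F) t a = 0.
Proof.
move=> [_ t_skew].
have G_sym b d : invmx (metric F) b d = invmx (metric F) d b.
  by rewrite -[in LHS](Defs.metric_sym F) -trmx_inv mxE.
have /eqP : trace23 (metric F) t a = - trace23 (metric F) t a.
  rewrite {2}/trace23 exchange_big -sumrN; apply: eq_bigr => b _.
  by rewrite -sumrN; apply: eq_bigr => d _; rewrite t_skew G_sym mulrN.
by rewrite -subr_eq0 opprK -mulr2n mulrn_eq0 /= => /eqP.
Qed.

(* The component of [delta S] in S^3 H is, for S u = al u + K u with al u in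
   gl(n, H) and K u in sp(1), of the form g_bc s_a - g_ac s_b: the gl(n, H)-part
   is antisymmetric in two of the H-indices. *)
Lemma X12_delta_normalizer (T : V -> V -> V) (al K : V -> 'M[R]_(4 * n)) :
  (0 < n)%N -> X12 F T -> (forall u, q (K u)) ->
  (forall u, qinv (fun v z => cbil (al u *m v) z)) ->
  (forall u v, T u v = (al u + K u) *m v - (al v + K v) *m u) ->
  forall u v z, bil w (T u v) z = 0.
Proof.
move=> n0 [T1 [T2 [[t1 [t1s1 t1s2 t1K t1E]] [t2 [t2s1 t2s2 t2L t2E]] T12]]] qK al_inv TE.
pose t A B D : tensor3 R n := fun a b c => t1 A B D a b c + t2 A B D a b c.
have ts1 A B D a b c : t B A D a b c = t A B D a b c by rewrite /t t1s1 t2s1.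
have ts2 A B D a b c : t A D B a b c = t A B D a b c by rewrite /t t1s2 t2s2.
have t_tr A B D a : trace23 (metric F) (t A B D) a = 0.
  have [_ _ t1tr] := t1K A B D.
  transitivity (trace23 (metric F) (t1 A B D) a + trace23 (metric F) (t2 A B D) a).
    rewrite /trace23 -big_split; apply: eq_bigr => b _; rewrite -big_split.
    by apply: eq_bigr => d _; rewrite mulrDr.
  by rewrite t1tr trace23_Lambda3E // addr0.
have tE u v z : cbil (T u v) z = \sum_A \sum_B \sum_D \sum_a \sum_b \sum_c
    t A B D a b c * F u a A * F v b B * F z c D.
  rewrite T12 /cbil bilDl rmorphD /= t1E t2E.
  do 6!(rewrite -big_split; apply: eq_bigr => ? _).
  by rewrite /t !mulrDl.
have sex u : exists s, sp1 s /\ forall v, F (K u *m v) = F v *m s^T.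
  by have /(frame_quaternionic F) [s s1 sE] := qK u; exists s.
have [s /all_and2 [s1 sE]] := choice sex.
(* [k u] is the sp(1)-part of S u with an index lowered, hence symmetric in B, D. The gl(n, H)-part
   is sp(1)-invariant, so its components are [e] times [epsH]. *)
pose k u B D := \sum_B' s u B' B * epsH R B' D.
have k_sym u B D : k u B D = k u D B by apply: sp1_eps_sym.
pose sg a A B D := cpl (fun u => k u B D) a A.
have sg_sym a A B D : sg a A B D = sg a A D B by apply: eq_cpl => u.
pose e a A b c := cpl (fun u => cpl2 (fun v z => cbil (al u *m v) z) b 0 c 1) a A.
have SE a A b B c D : cpl3 (fun u v z => cbil ((al u + K u) *m v) z) a A b B c D =
    e a A b c * epsH R B D + metric F b c * sg a A B D.
  transitivity (cpl (fun u => cpl2 (fun v z => cbil (al u *m v) z) b 0 c 1 * epsH R B D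
    + metric F b c * k u B D) a A).
    apply: eq_cpl => u; rewrite -(cpl2_cbil_sp1 b B c D (sE u)) -qinv_cpl2 //.
    - transitivity (cpl2 (fun v z => cbil (al u *m v) z + cbil (K u *m v) z) b B c D).
        by apply: eq_cpl2 => v z; rewrite /cbil mulmxDl bilDl rmorphD.
      by rewrite /cpl2 /cpl; ring.
    - by move=> v; apply: rlin_cbil.
    - by move=> z; apply: rlin_cbil_mulmxl.
  by rewrite cplD cplMr cplMl.
clearbody sg e.
have tS A B D a b c : t A B D a b c =
    e a A b c * epsH R B D + metric F b c * sg a A B D -
    (e b B a c * epsH R A D + metric F a c * sg b B A D).
  rewrite -!SE -(cpl3_coef t a A b B c D).
  transitivity (cpl3 (fun u v z => cbil ((al u + K u) *m v) z -
                                   cbil ((al v + K v) *m u) z) a A b B c D).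
    by apply: eq_cpl3 => u v z; rewrite -tE TE /cbil bilBl rmorphB.
  by rewrite cpl3B; congr (_ - _); apply: cpl3_flip.
pose sc A B D a := sg a A B D + sg a B D A + sg a D A B.
have epsN B D : epsH R B D = - epsH R D B by rewrite !mxE opprB.
(* Sum [tS] over the six orders of A, B, D. The left side becomes 6 t; on the right the terms with
   [epsH] cancel in pairs, and [sg], symmetric in its last two indices, gives twice its cyclic sum
   [sc]. *)
have t3 A B D a b c : 3%:R * t A B D a b c =
    metric F b c * sc A B D a - metric F a c * sc A B D b.
  have two0 : (2 : C) != 0 by rewrite pnatr_eq0.
  apply: (mulfI two0).
  have -> : 2 * (3%:R * t A B D a b c) = t A B D a b c + t A D B a b c +
     t B A D a b c + t B D A a b c + t D A B a b c + t D B A a b c.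
    have -> : t B D A a b c = t A B D a b c by rewrite ts2 ts1.
    have -> : t D A B a b c = t A B D a b c by rewrite ts1 ts2.
    have -> : t D B A a b c = t A B D a b c by rewrite ts1 ts2 ts1.
    by rewrite (ts1 A B) (ts2 A B D); ring.
  rewrite !tS (epsN D B) (epsN D A) (epsN B A) /sc.
  rewrite (sg_sym a A D B) (sg_sym a B D A) (sg_sym a D B A).
  by rewrite (sg_sym b A D B) (sg_sym b B D A) (sg_sym b D B A); ring.
(* Contracting b with c turns g_bc into dim E = 2n and g_ac s_b into s_a. *)
have sc0 A B D a : sc A B D a = 0.
  have : 3%:R * trace23 (metric F) (t A B D) a = ((2 * n).-1)%:R * sc A B D a.
    transitivity (\sum_b \sum_d invmx (metric F) b d * (metric F b d * sc A B D a) -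
                  \sum_b \sum_d invmx (metric F) b d * (metric F a d * sc A B D b)).
      rewrite -sumrB mulr_sumr; apply: eq_bigr => b _; rewrite -sumrB mulr_sumr.
      by apply: eq_bigr => d _; rewrite -mulrBr -t3; ring.
    rewrite trace_sum_metric trace_metric_vec -[X in _ - X]mul1r -mulrBl.
    by congr (_ * _); rewrite -subn1 natrB // muln_gt0.
  rewrite t_tr mulr0 => /esym/eqP; rewrite mulf_eq0 pnatr_eq0.
  by rewrite (negPf (double_pred_neq0 n0)) => /eqP.
move=> u v z; apply: (@complexI R); rewrite -/(cbil _ _) tE rmorph0.
do 6!(apply: big1 => ? _); rewrite [t _ _ _ _ _ _](_ : _ = 0) ?mul0r //.
have three0 : (3%:R : C) != 0 by rewrite pnatr_eq0.
by apply: (mulfI three0); rewrite t3 !sc0; ring.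
Qed.

Lemma rlin_bigsum (I : finType) (f : I -> V -> C) :
  (forall i, rlin (f i)) -> rlin (fun v => \sum_i f i v).
Proof.
by move=> fl a u v; rewrite mulr_sumr -big_split; apply: eq_bigr => i _; apply: fl.
Qed.

Lemma rlin_cpl (f : V -> V -> C) a A :
  (forall v, rlin (f ^~ v)) -> rlin (fun u => cpl (f u) a A).
Proof. by move=> fl r u v; rewrite /cpl !fl; ring. Qed.

Lemma cpl3_eq0 (T : V -> V -> V -> C) :
  (forall v z, rlin (fun u => T u v z)) -> (forall u z, rlin (fun v => T u v z)) ->
  (forall u v, rlin (T u v)) ->
  (forall a A b B c D, cpl3 T a A b B c D = 0) -> forall u v z, T u v z = 0.
Proof.
move=> l1 l2 l3 T0 u v z.
apply: (cpl_eq0 (l3 u v)) => c D.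
apply: (@cpl_eq0 (fun v => cpl (T u v) c D)) => [|b B]; first exact: rlin_cpl.
apply: (@cpl_eq0 (fun u => cpl2 (T u) b B c D)) => [|a A]; last exact: T0.
by apply: rlin_cpl => v'; apply: rlin_cpl.
Qed.

Definition tri (t : 'I_2 -> 'I_2 -> 'I_2 -> tensor3 R n) u v z : C :=
  \sum_A \sum_B \sum_D \sum_a \sum_b \sum_c
    t A B D a b c * F u a A * F v b B * F z c D.

Lemma tri_rlin1 t v z : rlin (fun u => tri t u v z).
Proof.
do 6!apply: rlin_bigsum => ?; move=> r u u'.
by rewrite (frame_linear F) !mxE; ring.
Qed.

Lemma tri_rlin2 t u z : rlin (fun v => tri t u v z).
Proof.
do 6!apply: rlin_bigsum => ?; move=> r v v'.
by rewrite (frame_linear F) !mxE; ring.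
Qed.

Lemma tri_rlin3 t u v : rlin (tri t u v).
Proof.
do 6!apply: rlin_bigsum => ?; move=> r z z'.
by rewrite (frame_linear F) !mxE; ring.
Qed.

Lemma triK (T : V -> V -> V -> C) (t : 'I_2 -> 'I_2 -> 'I_2 -> tensor3 R n) :
  (forall v z, rlin (fun u => T u v z)) -> (forall u z, rlin (fun v => T u v z)) ->
  (forall u v, rlin (T u v)) ->
  (forall a A b B c D, cpl3 T a A b B c D = t A B D a b c) ->
  forall u v z, T u v z = tri t u v z.
Proof.
move=> l1 l2 l3 Tt u v z; apply/eqP; rewrite -subr_eq0; apply/eqP; move: u v z.
apply: (@cpl3_eq0 (fun u v z => T u v z - tri t u v z)).
- by move=> v z r u u'; rewrite l1 tri_rlin1; ring.
- by move=> u z r v v'; rewrite l2 tri_rlin2; ring.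
- by move=> u v r z z'; rewrite l3 tri_rlin3; ring.
- by move=> a A b B c D; rewrite cpl3B Tt cpl3_coef subrr.
Qed.

Lemma cpl3_rot f a A b B c D :
  cpl3 (fun u v z => f v z u) a A b B c D = cpl3 f b B c D a A.
Proof. by rewrite /cpl3 /cpl2 /cpl; ring. Qed.

Lemma cpl3_rot2 f a A b B c D :
  cpl3 (fun u v z => f z u v) a A b B c D = cpl3 f c D a A b B.
Proof. by rewrite /cpl3 /cpl2 /cpl; ring. Qed.

Lemma cpl3_cst0 a A b B c D : cpl3 (fun _ _ _ => 0) a A b B c D = 0.
Proof. by rewrite /cpl3 /cpl2 /cpl; ring. Qed.

(** The trace may be computed in the complex basis of E (x) H: the standard coordinates [co i] are
    real-linear functionals, and [cplK] expands each of them. *)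
Lemma mxtrace_cpl M : (\tr M)%:C = \sum_a \sum_A cpl (fun v => F (M *m v) a A) a A.
Proof.
pose co i (v : V) : C := (v i 0)%:C.
have co_lin i : rlin (co i) by move=> r u v; rewrite /co !mxE rmorphD rmorphM.
have Fl a A : rlin (fun v => F (M *m v) a A).
  by move=> r u v; rewrite mulmxDr -scalemxAr (frame_linear F) !mxE.
have FE a A v : F (M *m v) a A = \sum_i co i v * F (M *m delta_mx i 0) a A.
  rewrite -[v in LHS]trmxK {1}[v^T]row_sum_delta linear_sum (rlin_sum _ (Fl a A)).
  apply: eq_bigr => i _; rewrite linearZ /= trmx_delta -/(F _) (rlinZ _ _ (Fl a A)).
  by rewrite mxE.
rewrite /mxtrace rmorph_sum /=.
under [RHS]eq_bigr => a _.
  under eq_bigr => A _.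
    rewrite (eq_cpl _ _ (FE a A)) cpl_sum.
    under eq_bigr do rewrite cplMr.
    over.
  rewrite exchange_big; over.
rewrite exchange_big; apply: eq_bigr => i _.
have -> : M i i = (M *m (delta_mx i 0 : V)) i 0.
  rewrite mxE -[LHS](big_kron (fun j => M i j) i); apply: eq_bigr => j _.
  by rewrite !mxE andbT.
exact: (cplK (co_lin i)).
Qed.

(** Contraction with the inverse metric produces the partial trace [P] of M over E. By invariance P
    is the scalar s on H, so that tr M = 2 s. *)
Lemma trace_cpl2_cbil M : \tr M = 0 -> qinv (fun v z => cbil (M *m v) z) ->
  \sum_b \sum_c invmx (metric F) b c * cpl2 (fun v z => cbil (M *m v) z) b 0 c 1 = 0.
Proof.
move=> trM M_inv; pose f v z := cbil (M *m v) z.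
pose s := \sum_b \sum_c invmx (metric F) b c * cpl2 f b 0 c 1; rewrite -/f -/s.
pose m b B b' B' := cpl (fun v => F (M *m v) b B) b' B'.
have fE b' B' c D : cpl2 f b' B' c D =
    \sum_b \sum_B metric F b c * epsH R B D * m b B b' B'.
  rewrite /cpl2; transitivity (cpl (fun v => \sum_b \sum_B
    metric F b c * epsH R B D * F (M *m v) b B) b' B').
    apply: eq_cpl => v; rewrite /f.
    rewrite (cplK (f := fun x => cpl (cbil x) c D)); last first.
      by move=> a x y; rewrite /cpl /cbil !bilDl !bilZl !rmorphD !rmorphM /=; ring.
    apply: eq_bigr => b _; apply: eq_bigr => B _; congr (_ * _).
    exact: cpl2_cbil.
  by rewrite cpl_sum; apply: eq_bigr => b _; rewrite cpl_sum;
    apply: eq_bigr => B _; rewrite cplMl.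
pose P B B' := \sum_b m b B b B'.
have sE B' D : s * epsH R B' D = \sum_B epsH R B D * P B B'.
  transitivity (\sum_b' \sum_c invmx (metric F) b' c * cpl2 f b' B' c D).
    rewrite /s mulr_suml; apply: eq_bigr => b _; rewrite mulr_suml.
    apply: eq_bigr => c _; rewrite (qinv_cpl2 _ _ _ b B') ?mulrA //.
      by move=> v; apply: rlin_cbil.
    by move=> z; apply: rlin_cbil_mulmxl.
  under eq_bigr => b' _.
    under eq_bigr => c _.
      rewrite fE mulr_sumr.
      under eq_bigr do rewrite mulr_sumr.
      over.
    rewrite exchange_big /=.
    under eq_bigr do rewrite exchange_big /=.
    rewrite exchange_big /=.
    over.
  rewrite exchange_big /=; apply: eq_bigr => B _; rewrite mulr_sumr.
  apply: eq_bigr => b' _.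
  rewrite -[RHS](big_kron (fun b => epsH R B D * m b B b' B') b').
  apply: eq_bigr => b _.
  have -> : (b == b')%:R = (invmx (metric F) *m metric F) b' b.
    by rewrite mulVmx ?metric_unit // mxE eq_sym.
  rewrite [X in _ * X]mxE mulr_sumr; apply: eq_bigr => c _.
  by rewrite (metricC b c); ring.
have l1 : lift ord0 ord0 = 1 :> 'I_2 by apply: val_inj.
have o0 : ord0 = 0 :> 'I_2 by apply: val_inj.
have := sE 0 1; have := sE 1 0; rewrite !big_ord_recl !big_ord0 !mxE l1 o0 /=.
rewrite !(subrr, subr0, sub0r, mul0r, add0r, addr0, mulr1, mul1r, mulrN1, mulN1r).
move=> /oppr_inj s11 s00.
have := mxtrace_cpl M; rewrite trM rmorph0 exchange_big !big_ord_recl big_ord0 l1 o0.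
move=> /esym/eqP; rewrite -[X in X == 0]/(P 0 0 + (P 1 1 + 0)) -s11 -s00 addr0.
by rewrite -mulr2n mulrn_eq0 /= => /eqP.
Qed.

Hypothesis w_inv : forall K, q K -> forall u v, bil w (K *m u) v = - bil w u (K *m v).

Lemma commute_qinv M : (forall K, q K -> K *m M = M *m K) ->
  qinv (fun v z => cbil (M *m v) z).
Proof.
move=> cM K qK u v; rewrite /cbil -rmorphD /= mulmxA -cM // -mulmxA w_inv //.
by rewrite addNr.
Qed.

Lemma S30EH_cyclic A : (forall a u v, A (a *: u + v) = a *: A u + A v) ->
  (forall u, S20E q w (A u)) ->
  (forall u v z, bil w (A u *m v) z + bil w (A v *m z) u + bil w (A z *m u) v = 0) ->
  S30EH F A.
Proof.
move=> A_lin A_S20 A_cyc; split => //.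
have A_inv u : qinv (fun v z => cbil (A u *m v) z).
  by have [_ cA _] := A_S20 u; apply: commute_qinv.
pose f u v z := cbil (A u *m v) z.
pose e u b c := cpl2 (f u) b 0 c 1.
(* A form that is skew in total and a multiple of the skew [epsH] on H is symmetric on E. *)
have e_sym u b c : e u c b = e u b c.
  have [_ _ A_skew] := A_S20 u.
  transitivity (- cpl2 (f u) b 1 c 0).
    rewrite /e /cpl2 -cpl_exchange -cplN; apply: eq_cpl => v; rewrite -cplN.
    by apply: eq_cpl => z; rewrite /f /cbil A_skew rmorphN.
  rewrite (qinv_cpl2 _ _ (A_inv u)) ?mxE /= ?sub0r ?mulrN1 ?opprK //.
    by move=> v; apply: rlin_cbil.
  by move=> z; apply: rlin_cbil_mulmxl.
have f_cpl3 a A' b B c D : cpl3 f a A' b B c D = cpl (fun u => e u b c) a A' * epsH R B D.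
  rewrite -cplMr; apply: eq_cpl => u; apply: (qinv_cpl2 _ _ (A_inv u)).
    by move=> v; apply: rlin_cbil.
  by move=> z; apply: rlin_cbil_mulmxl.
have f_cyc a A' b B c D : cpl3 f a A' b B c D + cpl3 f b B c D a A' + cpl3 f c D a A' b B = 0.
  rewrite -[X in _ + X + _](cpl3_rot f) -[X in _ + X](cpl3_rot2 f).
  rewrite -cpl3D -cpl3D -[RHS](cpl3_cst0 a A' b B c D); apply: eq_cpl3.
  by move=> u v z; rewrite /f /cbil -!rmorphD /= A_cyc.
pose t A' a b c := cpl (fun u => e u b c) a A'.
have t_sym23 A' a b c : t A' a c b = t A' a b c by apply: eq_cpl => u.
have t_cyc a A' b B c D : t A' a b c * epsH R B D + t B b c a * epsH R D A' +
    t D c a b * epsH R A' B = 0 by have := f_cyc a A' b B c D; rewrite !f_cpl3.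
(* With A' = B and D the other index, [epsH] vanishes in one term of [t_cyc], and the other two give
   t_abc = t_bca. *)
have t_sym12 A' a b c : t A' b a c = t A' a b c.
  rewrite -t_sym23; elim/ord2_ind: A'.
    have := t_cyc a 0 b 0 c 1; rewrite !mxE /=.
    rewrite !(subrr, subr0, sub0r, mulr0, addr0, mulr1, mulrN1) => /eqP.
    by rewrite subr_eq0 => /eqP ->.
  have := t_cyc a 1 b 1 c 0; rewrite !mxE /=.
  rewrite !(subrr, subr0, sub0r, mulr0, addr0, mulr1, mulrN1) addrC => /eqP.
  by rewrite subr_eq0 => /eqP ->.
exists t; split.
  move=> A'; split => // a; rewrite /trace23.
  transitivity (cpl (fun u => \sum_b \sum_c invmx (metric F) b c * e u b c) a A').
    rewrite cpl_sum; apply: eq_bigr => b _; rewrite cpl_sum.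
    by apply: eq_bigr => c _; rewrite cplMl.
  rewrite -[RHS](cpl_cst0 a A'); apply: eq_cpl => u.
  by have [trA _ _] := A_S20 u; apply: trace_cpl2_cbil.
apply: (@triK f (fun A' B D a b c => t A' a b c * epsH R B D)).
- move=> v z r u u'; rewrite /f A_lin mulmxDl -scalemxAl /cbil bilDl bilZl.
  by rewrite rmorphD rmorphM.
- by move=> u z; apply: rlin_cbil_mulmxl.
- by move=> u v; apply: rlin_cbil.
- by move=> *; rewrite f_cpl3.
Qed.

(** For totally symmetric t the cyclic sum is t_A eps_BD + t_B eps_DA + t_D eps_AB. It is skew in A,
    B, D, and three indices with two values leave no room for that. *)
Lemma cyclic_S30EH A : S30EH F A -> forall u v z,
  bil w (A u *m v) z + bil w (A v *m z) u + bil w (A z *m u) v = 0.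
Proof.
move=> [_ [t [t_S30 AE]]] u v z.
pose f := tri (fun A B D a b c => t A a b c * epsH R B D).
have fE x y k : (bil w (A x *m y) k)%:C = f x y k by apply: AE.
apply: (@complexI R); rewrite !rmorphD /= rmorph0 !fE; move: u v z.
apply: (@cpl3_eq0 (fun u v z => f u v z + f v z u + f z u v)).
- by move=> v z r u u'; rewrite /f tri_rlin1 tri_rlin3 tri_rlin2; ring.
- by move=> u z r v v'; rewrite /f tri_rlin1 tri_rlin3 tri_rlin2; ring.
- by move=> u v r z z'; rewrite /f tri_rlin1 tri_rlin3 tri_rlin2; ring.
move=> a A' b B c D; rewrite !cpl3D (cpl3_rot f) (cpl3_rot2 f) !cpl3_coef.
have t12 A0 x y k : t A0 y x k = t A0 x y k by have [h _ _] := t_S30 A0; apply: h.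
have t23 A0 x y k : t A0 x k y = t A0 x y k by have [_ h _] := t_S30 A0; apply: h.
rewrite (t23 B b a c) (t12 B a b c) (t12 D a c b) (t23 D a b c) !mxE.
by elim/ord2_ind: A'; elim/ord2_ind: B; elim/ord2_ind: D => /=; ring.
Qed.

End Complexification.

(** * Quaternionic structures and existence of frames *)

Section QuaternionicTriple.
Variables (R : realType) (m : nat) (q : set 'M[R]_m) (J1 J2 J3 : 'M[R]_m).

Definition quaternionic_triple : Prop :=
  [/\ J1 *m J1 = - 1%:M, J2 *m J2 = - 1%:M, J3 *m J3 = - 1%:M,
      J1 *m J2 = J3 /\ J2 *m J1 = - J3 &
      forall K, q K <-> exists a b c : R, K = a *: J1 + b *: J2 + c *: J3].

Hypothesis J_triple : quaternionic_triple.

Let J11 : J1 *m J1 = - 1%:M. Proof. by case: J_triple. Qed.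
Let J22 : J2 *m J2 = - 1%:M. Proof. by case: J_triple. Qed.
Let J12 : J1 *m J2 = J3. Proof. by case: J_triple => _ _ _ []. Qed.
Let J21 : J2 *m J1 = - J3. Proof. by case: J_triple => _ _ _ []. Qed.
Let qE K : q K <-> exists a b c : R, K = a *: J1 + b *: J2 + c *: J3.
Proof. by case: J_triple => _ _ _ _; apply. Qed.

Let J13 : J1 *m J3 = - J2.
Proof. by rewrite -J12 mulmxA J11 mulNmx mul1mx. Qed.
Let J31 : J3 *m J1 = J2.
Proof. by rewrite -[J3]opprK -J21 mulNmx -mulmxA J11 mulmxN mulmx1 opprK. Qed.
Let J32 : J3 *m J2 = - J1.
Proof. by rewrite -J12 -mulmxA J22 mulmxN mulmx1. Qed.
Let J23 : J2 *m J3 = J1.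
Proof. by rewrite -[J3]opprK -J21 mulmxN mulmxA J22 mulNmx mul1mx opprK. Qed.

Lemma triple_in1 : q J1.
Proof. by apply/qE; exists 1, 0, 0; rewrite scale1r !scale0r !addr0. Qed.

Lemma triple_in2 : q J2.
Proof. by apply/qE; exists 0, 1, 0; rewrite scale1r !scale0r add0r addr0. Qed.

Lemma triple_in3 : q J3.
Proof. by apply/qE; exists 0, 0, 1; rewrite scale1r !scale0r !add0r. Qed.

Lemma triple_subr K L : q K -> q L -> q (K - L).
Proof.
move=> /qE [a [b [c ->]]] /qE [a' [b' [c' ->]]]; apply/qE.
exists (a - a'), (b - b'), (c - c').
by apply/matrixP => i j; rewrite !mxE; ring.
Qed.

Lemma triple0 : q 0.
Proof. by rewrite -(subrr J1); apply: triple_subr; apply: triple_in1. Qed.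

(** Replacing v by J v in w (J u, J v) = w (u, v) gives w (J u, v) = - w (u, J v), which is linear
    in J and so extends from the three generators to q. *)
Lemma triple_invariant (w : 'M[R]_m) :
  (forall J, J = J1 \/ J = J2 \/ J = J3 ->
     forall u v, bil w (J *m u) (J *m v) = bil w u v) ->
  forall K, q K -> forall u v, bil w (K *m u) v = - bil w u (K *m v).
Proof.
move=> w_inv K /qE [a [b [c ->]]] u v.
have inv J : J *m J = - 1%:M -> (J = J1 \/ J = J2 \/ J = J3) ->
    bil w (J *m u) v = - bil w u (J *m v).
  by move=> JJ /w_inv h; rewrite -(h u (J *m v)) mulmxA JJ mulNmx mul1mx bilNr opprK.
have J33 : J3 *m J3 = - 1%:M by case: J_triple.
rewrite !mulmxDl -!scalemxAl !bilDl !bilDr !bilZl !bilZr !inv //; last 3 first.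
- by right; right.
- by right; left.
- by left.
by ring.
Qed.

Hypothesis m_gt0 : (0 < m)%N.

Lemma scalar_eq0 (a : R) : a *: (1%:M : 'M[R]_m) = 0 -> a = 0.
Proof.
move=> /matrixP/(_ (Ordinal m_gt0) (Ordinal m_gt0)).
by rewrite !mxE eqxx mulr1.
Qed.

(* The derivation [S, .] of the quaternions is inner. *)
Lemma normalizer_decomposition (S : 'M[R]_m) :
  (forall J, J = J1 \/ J = J2 -> q (S *m J - J *m S)) ->
  exists2 K, q K & forall L, q L -> L *m (S - K) = (S - K) *m L.
Proof.
move=> Sq.
have /qE [a1 [p [r E1]]] := Sq J1 (or_introl erefl).
have /qE [p' [b2 [s E2]]] := Sq J2 (or_intror erefl).
have SJ1 : S *m J1 = J1 *m S + (a1 *: J1 + p *: J2 + r *: J3) by rewrite -E1 addrC subrK.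
have SJ2 : S *m J2 = J2 *m S + (p' *: J1 + b2 *: J2 + s *: J3) by rewrite -E2 addrC subrK.
(* [S, .] is a derivation, so it kills J1^2 = -1, J2^2 = -1 and J1 J2 + J2 J1 = 0. These give [a10],
   [b20] and [pp'], and leave the three coefficients p, r, s. *)
have a10 : a1 = 0.
  have : S *m (J1 *m J1) = (J1 *m J1) *m S + (- (2 * a1)) *: 1%:M.
    rewrite mulmxA SJ1 mulmxDl -mulmxA SJ1 !mulmxDr !mulmxDl -!scalemxAl -!scalemxAr.
    rewrite mulmxA J11 J12 J13 J21 J31 !mulNmx !mul1mx.
    by apply/matrixP => i j; rewrite !mxE; ring.
  rewrite J11 mulmxN mulmx1 mulNmx mul1mx -[LHS]addr0 => /addrI/esym/scalar_eq0/eqP.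
  by rewrite oppr_eq0 mulf_eq0 pnatr_eq0 /= => /eqP.
have b20 : b2 = 0.
  have : S *m (J2 *m J2) = (J2 *m J2) *m S + (- (2 * b2)) *: 1%:M.
    rewrite mulmxA SJ2 mulmxDl -mulmxA SJ2 !mulmxDr !mulmxDl -!scalemxAl -!scalemxAr.
    rewrite mulmxA J22 J12 J23 J21 J32 !mulNmx !mul1mx.
    by apply/matrixP => i j; rewrite !mxE; ring.
  rewrite J22 mulmxN mulmx1 mulNmx mul1mx -[LHS]addr0 => /addrI/esym/scalar_eq0/eqP.
  by rewrite oppr_eq0 mulf_eq0 pnatr_eq0 /= => /eqP.
have pp' : p' = - p.
  have : S *m (J1 *m J2 + J2 *m J1) =
      (J1 *m J2 + J2 *m J1) *m S + (- (2 * (p' + p))) *: 1%:M.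
    rewrite mulmxDr !mulmxA SJ1 SJ2 !mulmxDl -!mulmxA SJ1 SJ2 a10 b20.
    rewrite !mulmxDr -!scalemxAl -!scalemxAr !mulmxA J11 J12 J13 J21 J31 J23 J32 J22.
    by apply/matrixP => i j; rewrite !mxE; ring.
  rewrite J12 J21 subrr mulmx0 mul0mx add0r => /esym/scalar_eq0/eqP.
  by rewrite oppr_eq0 mulf_eq0 pnatr_eq0 /= addr_eq0 => /eqP.
(* Solves [K, J1] = p J2 + r J3 and [K, J2] = - p J1 + s J3; the halves come from [J1, J2] = 2 J3
   and its cyclic images. *)
pose K := (s / 2) *: J1 + (- r / 2) *: J2 + (p / 2) *: J3.
have KJ1 : J1 *m (S - K) = (S - K) *m J1.
  rewrite mulmxBl SJ1 mulmxBr /K !mulmxDl !mulmxDr -!scalemxAl -!scalemxAr.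
  by rewrite J11 J12 J13 J21 J31 a10; apply/matrixP => i j; rewrite !mxE; field.
have KJ2 : J2 *m (S - K) = (S - K) *m J2.
  rewrite mulmxBl SJ2 mulmxBr /K !mulmxDl !mulmxDr -!scalemxAl -!scalemxAr.
  by rewrite J22 J12 J23 J21 J32 b20 pp'; apply/matrixP => i j; rewrite !mxE; field.
exists K; first by apply/qE; exists (s / 2), (- r / 2), (p / 2).
move=> L /qE [a [b [c ->]]].
have KJ3 : J3 *m (S - K) = (S - K) *m J3.
  by rewrite -J12 -mulmxA KJ2 mulmxA KJ1 mulmxA.
move: (S - K) KJ1 KJ2 KJ3 => N KJ1 KJ2 KJ3.
by rewrite !mulmxDl !mulmxDr -!scalemxAl -!scalemxAr KJ1 KJ2 KJ3.
Qed.

End QuaternionicTriple.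

(** * Construction of a frame from an admissible basis *)

Section FrameExistence.
Variables (R : realType) (n : nat).
Local Notation V := 'cV[R]_(4 * n).
Local Notation C := R[i].
Local Notation cx := (map_mx (real_complex R)).

Lemma conj_mx_real p r (A : 'M[R]_(p, r)) : conj_mx (cx A) = cx A.
Proof. by apply/matrixP => i j; rewrite !mxE conjc_real. Qed.

Lemma real_mxP p r (A : 'M[C]_(p, r)) : conj_mx A = A -> exists B, A = cx B.
Proof.
move=> AA; exists (map_mx (@complex.Re R) A); apply/matrixP => i j.
have /matrixP/(_ i j) := AA; rewrite !mxE; case: (A i j) => x y /= [] yy.
congr Complex; apply/eqP; move/eqP: yy.
by rewrite -subr_eq0 -opprD oppr_eq0 -mulr2n mulrn_eq0.
Qed.

(** The rows of [P] are a basis of the linear forms of type (1, 0) for J, and v -> P v identifies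
    (V, J) with C^2n. The columns of [S] are the dual basis of the vectors of type (1, 0). *)
Lemma eigenbasis (J : 'M[R]_(4 * n)) : J *m J = - 1%:M ->
  exists P : 'M[C]_(2 * n, 4 * n), [/\ P *m cx J = 'i%C *: P &
    forall v : V, P *m cx v = 0 -> v = 0] /\
  (forall x : 'cV[C]_(2 * n), exists v : V, P *m cx v = x) /\
  exists S : 'M[C]_(4 * n, 2 * n), [/\ P *m S = 1%:M, P *m conj_mx S = 0 &
    S *m P + conj_mx S *m conj_mx P = 1%:M].
Proof.
move=> JJ.
have ii : 'i%C * 'i%C = -1 :> C by rewrite -expr2 sqr_i.
have cJJ : cx J *m cx J = - 1%:M by rewrite -map_mxM JJ map_mxN map_mx1.
pose Ap := cx J - 'i%C%:M; pose Am := cx J + 'i%C%:M.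
have Am_conj : Am = conj_mx Ap.
  rewrite /conj_mx /Ap map_mxB -/(conj_mx _) conj_mx_real map_scalar_mx.
  rewrite [X in X%:M](_ : _ = - 'i%C); last exact: conjc_i.
  by rewrite [in RHS]raddfN opprK.
have ApAm : Ap *m Am = 0.
  rewrite mulmxBl !mulmxDr cJJ -!scalar_mxC !mul_scalar_mx scale_scalar_mx ii.
  by rewrite raddfN /= [- _ + _]addrC subrr.
have rank_eq : \rank Am = \rank Ap by rewrite Am_conj mxrank_map.
(* [Ap *m Am = 0] bounds the sum of the two ranks by 4n from above, and the invertible matrix
   [Am - Ap] = 2i bounds it from below; conjugate matrices have equal ranks. *)
have rank_Ap : \rank Ap = (2 * n)%N.
  have le : (\rank Ap + \rank Am <= 4 * n)%N by apply: mulmx0_rank_max.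
  have ge : (4 * n <= \rank Ap + \rank Am)%N.
    have r4 : \rank (Am - Ap) = (4 * n)%N.
      have -> : Am - Ap = (2 * 'i%C)%:M.
        apply/matrixP => i j; rewrite !mxE.
        by case: (i == j); rewrite ?mulr1n ?mulr0n; ring.
      apply/mxrank_unit; rewrite unitmxE det_scalar unitfE expf_eq0 negb_and.
      by rewrite mulf_eq0 pnatr_eq0 /= eq_complex /= oner_eq0 andbF orbT.
    rewrite addnC -[X in (X <= _)%N]r4 -[X in (_ <= _ + X)%N]mxrank_opp.
    exact: mxrank_add.
  have : (\rank Ap + \rank Am)%N = (4 * n)%N by apply/eqP; rewrite eqn_leq le.
  rewrite rank_eq addnn -mul2n => r2; apply/eqP.
  by rewrite -(eqn_pmul2l (m := 2)) // r2 mulnA.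
have rank_ker : \rank (kermx Ap) = (2 * n)%N.
  by rewrite mxrank_ker rank_Ap -mulnBl.
have [P [P_free P_eig]] : exists P : 'M[C]_(2 * n, 4 * n),
    row_free P /\ P *m Ap = 0.
  rewrite -rank_ker; exists (row_base (kermx Ap)); split.
    exact: row_base_free.
  by apply/sub_kermxP; rewrite eq_row_base.
have PJ : P *m cx J = 'i%C *: P.
  by move/eqP: P_eig; rewrite mulmxBr subr_eq0 mul_mx_scalar => /eqP.
have PcJ : conj_mx P *m cx J = - ('i%C *: conj_mx P).
  have := congr1 (@conj_mx R _ _) PJ.
  by rewrite conj_mxM conj_mx_real conj_mxZ conjc_i scaleNr.
have rankP : \rank P = (2 * n)%N by apply/eqP.
pose B := col_mx P (conj_mx P).
have PcP : (P :&: conj_mx P)%MS = 0.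
  set W := (_ :&: _)%MS.
  have [/submxP [D1 E1] /submxP [D2 E2]] : (W <= P)%MS /\ (W <= conj_mx P)%MS.
    by rewrite capmxSl capmxSr.
  have : W *m cx J = 'i%C *: W by rewrite E1 -mulmxA PJ scalemxAr.
  rewrite {1}E2 -mulmxA PcJ mulmxN -scalemxAr -E2 => /eqP.
  rewrite eq_sym -addr_eq0 -scalerDl scaler_eq0 => /orP [|/eqP //].
  by rewrite -mulr2n mulrn_eq0 /= eq_complex /= oner_eq0 andbF.
have rankB : \rank B = (4 * n)%N.
  transitivity (\rank (P + conj_mx P)%MS); first by rewrite addsmxE.
  have := mxrank_sum_cap P (conj_mx P); rewrite PcP mxrank0 addn0 => ->.
  by rewrite [\rank (conj_mx P)]mxrank_map rankP -mulnDl.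
have /row_fullP [X XB] : row_full B by rewrite /row_full rankB.
have /row_freeP [Y BY] : row_free B by rewrite /row_free rankB -mulnDl.
have XY : X = Y by rewrite -[X]mulmx1 -BY mulmxA XB mul1mx.
rewrite -XY in BY; pose S := lsubmx X; pose S' := rsubmx X.
have XE : X = row_mx S S' by rewrite hsubmxK.
have SP : S *m P + S' *m conj_mx P = 1%:M by rewrite -XB XE mul_row_col.
move: BY; rewrite XE mul_col_row (scalar_mx_block (2 * n) (2 * n)).
move=> /eq_block_mx [PS PS' cPS cPS'].
(* Conjugation exchanges the two blocks of rows of [B], hence the two blocks of columns of its
   inverse. *)
have S'E : S' = conj_mx S.
  have := congr1 (@conj_mx R _ _) SP; rewrite conj_mxD !conj_mxM conj_mxK.
  have -> : conj_mx (1%:M : 'M[C]_(4 * n)) = 1%:M by apply: map_mx1.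
  move=> /(congr1 (fun Z => Z *m S')).
  by rewrite mulmxDl -!mulmxA cPS' PS' mulmx0 addr0 mulmx1 mul1mx.
rewrite S'E in SP PS' cPS'.
exists P; split; [split=> // v Pv|split; last by exists S].
  have cPv : conj_mx P *m cx v = 0.
    have := congr1 (@conj_mx R _ _) Pv; rewrite conj_mxM conj_mx_real => ->.
    exact: map_mx0.
  apply: (@map_mx_inj _ _ (real_complex R)); rewrite map_mx0 -[LHS]mul1mx -SP.
  by rewrite mulmxDl -!mulmxA Pv cPv !mulmx0 addr0.
move=> x; have [v vE] : exists v, S *m x + conj_mx S *m conj_mx x = cx v.
  by apply: real_mxP; rewrite conj_mxD !conj_mxM !conj_mxK addrC.
by exists v; rewrite -vE mulmxDr !mulmxA PS PS' mul1mx mul0mx addr0.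
Qed.

Lemma scale_i_eq0 p r (X : 'M[C]_(p, r)) : 'i%C *: X = - ('i%C *: X) -> X = 0.
Proof.
move/eqP; rewrite -addr_eq0 -scalerDl scaler_eq0 => /orP [|/eqP //].
by rewrite -mulr2n mulrn_eq0 /= eq_complex /= oner_eq0 andbF.
Qed.

Lemma cx_bil (w : 'M[R]_(4 * n)) u v :
  (bil w u v)%:C = ((cx u)^T *m cx w *m cx v) 0 0.
Proof. by rewrite /bil map_trmx -!map_mxM [RHS]mxE. Qed.

Lemma bil_delta m (w : 'M[R]_m) i j : bil w (delta_mx i 0) (delta_mx j 0) = w i j.
Proof. by rewrite /bil trmx_delta -rowE -colE !mxE. Qed.

Lemma isotropic_sum_form (K : comNzRingType) (m p : nat) (S S' : 'M[K]_(m, p))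
    (W : 'M[K]_m) (x x' y y' : 'cV[K]_p) :
  S^T *m W *m S = 0 -> S'^T *m W *m S' = 0 ->
  (S *m x + S' *m x')^T *m W *m (S *m y + S' *m y') =
  x^T *m (S^T *m W *m S') *m y' + x'^T *m (S'^T *m W *m S) *m y.
Proof.
move=> SWS SWS'.
have D (a b : 'cV[K]_m) : (a + b)^T = a^T + b^T by rewrite linearD.
have E (A B : 'M[K]_(m, p)) (a b : 'cV[K]_p) :
    (A *m a)^T *m W *m (B *m b) = a^T *m (A^T *m W *m B) *m b.
  by rewrite trmx_mul !mulmxA.
rewrite D !mulmxDl !mulmxDr !E SWS SWS' !mulmx0 !mul0mx add0r addr0.
by [].
Qed.

(** E is the tangent space with complex structure J1, identified with C^2n by [phi], and the two
    columns of the frame are phi v and phi (J2 v). The antilinear J2 has matrix [U], which becomes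
    the quaternionic structure of E; the metric [g] is what is left of w after composing with J2. *)
Lemma frame_exists (q : set 'M[R]_(4 * n)) (w J1 J2 J3 : 'M[R]_(4 * n)) :
  quaternionic_triple q J1 J2 J3 -> w \in unitmx ->
  (forall u v, bil w u v = - bil w v u) ->
  (forall J, J = J1 \/ J = J2 \/ J = J3 ->
     forall u v, bil w (J *m u) (J *m v) = bil w u v) ->
  inhabited (EHframe q w).
Proof.
move=> [J11 J22 J33 [J12 J21] qE] w_unit w_skew w_inv.
have [P [[PJ1 P_inj] [P_surj [S [PS PcS SP]]]]] := eigenbasis J11.
have ii : 'i%C * 'i%C = -1 :> C by rewrite -expr2 sqr_i.
have cjM := conj_mxM; have cjK := conj_mxK; have cjR := conj_mx_real.
have cj1 m : conj_mx (1%:M : 'M[C]_m) = 1%:M by apply: map_mx1.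
have cj0 m p : conj_mx (0 : 'M[C]_(m, p)) = 0 by apply: map_mx0.
have cjN m p (A : 'M[C]_(m, p)) : conj_mx (- A) = - conj_mx A by apply: map_mxN.
have cjT m p (A : 'M[C]_(m, p)) : conj_mx A^T = (conj_mx A)^T.
  by rewrite /conj_mx map_trmx.
have cPcS : conj_mx P *m conj_mx S = 1%:M by rewrite -cjM PS cj1.
have cPS : conj_mx P *m S = 0 by rewrite -[S]cjK -cjM PcS cj0.
pose j1 := cx J1; pose j2 := cx J2; pose W := cx w.
have j21 : j2 *m j1 = - (j1 *m j2).
  by rewrite -!map_mxM J21 J12 map_mxN.
have j22 : j2 *m j2 = - 1%:M by rewrite -map_mxM J22 map_mxN map_mx1.
have cPj1 : conj_mx P *m j1 = - ('i%C *: conj_mx P).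
  have := congr1 (@conj_mx R _ _) PJ1.
  by rewrite cjM cjR conj_mxZ conjc_i scaleNr.
have j1S : j1 *m S = 'i%C *: S.
  rewrite -[LHS]mul1mx -SP mulmxDl -[S *m P *m _]mulmxA -[X in _ + X]mulmxA.
  rewrite (mulmxA P) PJ1 (mulmxA (conj_mx P)) cPj1 -scalemxAl PS mulNmx.
  by rewrite -!scalemxAl cPS scaler0 oppr0 mulmx0 addr0 scalemx1 mul_mx_scalar.
(* J2 anticommutes with J1, so it exchanges the types (1, 0) and (0, 1). *)
have Pj2S : P *m j2 *m S = 0.
  apply: scale_i_eq0; transitivity (P *m j2 *m (j1 *m S)).
    by rewrite j1S scalemxAr.
  rewrite mulmxA -(mulmxA P) j21 mulmxN mulmxA PJ1 mulNmx.
  by rewrite -!scalemxAl.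
pose U := P *m j2 *m conj_mx S.
have cU : conj_mx U = conj_mx P *m j2 *m S by rewrite /U !cjM cjR cjK.
have Pj2 : P *m j2 = U *m conj_mx P.
  by rewrite -[LHS]mulmx1 -SP mulmxDr !mulmxA Pj2S mul0mx add0r.
have cPj2 : conj_mx P *m j2 = conj_mx U *m P.
  by have := congr1 (@conj_mx R _ _) Pj2; rewrite cjM cjR => ->; rewrite cjM cjK.
have UU : U *m conj_mx U = - 1%:M.
  by rewrite cU !mulmxA -Pj2 -(mulmxA P) j22 mulmxN mulmx1 mulNmx PS.
have cUU : conj_mx U *m U = - 1%:M by rewrite -[U in X in _ *m X]cjK -cjM UU cjN cj1.
have j2cS : j2 *m conj_mx S = S *m U.
  rewrite -[LHS]mul1mx -SP mulmxDl -!mulmxA (mulmxA P) -/U (mulmxA (conj_mx P)).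
  by rewrite cPj2 -(mulmxA (conj_mx U)) PcS !mulmx0 addr0.
have j2S : j2 *m S = conj_mx S *m conj_mx U.
  by have := congr1 (@conj_mx R _ _) j2cS; rewrite cjM cjR cjK => ->; rewrite cjM.
clearbody U.
have W_skew : W^T = - W.
  apply/matrixP => i j; rewrite !mxE -rmorphN; congr (_%:C).
  by have := w_skew (delta_mx j 0) (delta_mx i 0); rewrite !bil_delta.
have W_inv J : (J = J1 \/ J = J2 \/ J = J3) -> (cx J)^T *m W *m cx J = W.
  move=> /w_inv Jw; rewrite map_trmx -!map_mxM; congr (cx _).
  by apply/matrixP => i j; rewrite -!bil_delta -Jw /bil trmx_mul !mulmxA.
have Wj1 : j1^T *m W *m j1 = W by apply: W_inv; left.
have Wj2 : j2^T *m W *m j2 = W by apply: W_inv; right; left.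
(* Invariance of w under J1 multiplies its value on two vectors of type (1, 0) by i^2 = -1. *)
have SWS : S^T *m W *m S = 0.
  have : S^T *m (j1^T *m W *m j1) *m S = - (S^T *m W *m S).
    have iT : ('i%C *: S)^T = 'i%C *: S^T by rewrite linearZ.
    rewrite !mulmxA -trmx_mul j1S -(mulmxA _ j1) j1S iT.
    by rewrite -!scalemxAl -scalemxAr scalerA ii scaleN1r.
  rewrite Wj1 => /eqP; rewrite -addr_eq0 -mulr2n -scaler_nat scaler_eq0.
  by rewrite pnatr_eq0 /= => /eqP.
pose h := S^T *m W *m conj_mx S.
have ch : conj_mx h = (conj_mx S)^T *m W *m S by rewrite /h !cjM cjT cjR cjK.
have hT : h^T = - conj_mx h.
  by rewrite ch /h !trmx_mul trmxK W_skew mulmxA mulmxN mulNmx.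
have hU : U^T *m h *m conj_mx U = conj_mx h.
  have E : (conj_mx S)^T *m j2^T = U^T *m S^T by rewrite -trmx_mul j2cS trmx_mul.
  by rewrite ch -[in RHS]Wj2 !mulmxA -[_ *m S]mulmxA j2S E /h !mulmxA.
have hE : h = S^T *m W *m conj_mx S by [].
(* Chosen so that g U = h, as U conj U = -1. Invariance of w under J2 is what makes g symmetric. *)
clearbody h; pose g := - (h *m conj_mx U).
have hcUg : h *m conj_mx U = - g by rewrite opprK.
have UhT : (conj_mx U)^T *m conj_mx h = g.
  have := congr1 (@conj_mx R _ _) hU; rewrite !cjM cjT !cjK => hU'.
  by rewrite /g -[in RHS]hU' -!mulmxA UU !mulmxN mulmx1 opprK.
have g_sym : g^T = g.
  by rewrite -[in RHS]UhT /g linearN /= trmx_mul hT mulmxN opprK.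
have gU : g *m U = h by rewrite mulNmx -mulmxA cUU mulmxN mulmx1 opprK.
have Ug : U^T *m g = - conj_mx h by rewrite mulmxN mulmxA hU.
have quat_metric : U^T *m g *m U = conj_mx g.
  by rewrite Ug mulNmx /g cjN cjM cjK.
(* In the basis given by S and conj S, W has only the off-diagonal blocks h and conj h, so an
   off-diagonal block [k] of its inverse inverts h. *)
have g_unit : g \in unitmx.
  pose k := conj_mx P *m invmx W *m P^T.
  have W_unit : W \in unitmx by rewrite map_unitmx.
  have hk : h *m k = 1%:M.
    rewrite hE /k !mulmxA -(mulmxA _ (conj_mx S)).
    have -> : conj_mx S *m conj_mx P = 1%:M - S *m P by rewrite -SP addrC addKr.
    rewrite mulmxBr mulmx1 [_ *m (S *m P)]mulmxA SWS mul0mx subr0.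
    by rewrite -(mulmxA S^T) mulmxV // mulmx1 -trmx_mul PS trmx1.
  have : g *m (U *m k) = 1%:M by rewrite mulmxA gU hk.
  by case/mulmx1_unit.
pose phi (v : V) : 'cV[C]_(2 * n) := P *m cx v.
have phi_lin a u v : phi (a *: u + v) = a%:C *: phi u + phi v.
  by rewrite /phi map_mxD map_mxZ mulmxDr scalemxAr.
have phi_j1 v : phi (J1 *m v) = 'i%C *: phi v.
  by rewrite /phi map_mxM mulmxA PJ1 scalemxAl.
have phi_j2 v : phi (J2 *m v) = U *m conj_mx (phi v).
  by rewrite /phi map_mxM mulmxA Pj2 cjM cjR mulmxA.
have vE v : cx v = S *m phi v + conj_mx S *m conj_mx (phi v).
  by rewrite -[LHS]mul1mx -SP mulmxDl /phi cjM cjR !mulmxA.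
have phi_inj u v : phi u = phi v -> u = v.
  move=> uv; apply/eqP; rewrite -subr_eq0; apply/eqP/P_inj.
  by rewrite map_mxB mulmxBr -!/(phi _) uv subrr.
have phi0 : phi 0 = 0 by rewrite /phi map_mx0 mulmx0.
have phiE v : phi v = P *m cx v by [].
clearbody phi; pose Fr (v : V) : 'M[C]_(2 * n, 2) :=
  \matrix_(a, A) (if A == 0 then phi v a 0 else phi (J2 *m v) a 0).
have FrE0 v a : Fr v a 0 = phi v a 0 by rewrite mxE.
have FrE1 v a : Fr v a 1 = phi (J2 *m v) a 0 by rewrite mxE.
have l1 : lift ord0 ord0 = 1 :> 'I_2 by apply: val_inj.
have o0 : ord0 = 0 :> 'I_2 by apply: val_inj.
have Fr_lin a u v : Fr (a *: u + v) = a%:C *: Fr u + Fr v.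
  apply/matrixP => i A; rewrite !mxE; case: ifP => _.
    by rewrite phi_lin !mxE.
  by rewrite mulmxDr -scalemxAr phi_lin !mxE.
have Fr_inj : injective Fr.
  move=> u v /matrixP uv; apply: phi_inj; apply/matrixP => a j.
  by rewrite ord1; have := uv a 0; rewrite !FrE0.
have epsE (X : 'M[C]_(2 * n, 2)) a :
    ((X *m epsH R) a 0 = - X a 1) * ((X *m epsH R) a 1 = X a 0).
  by split; rewrite !mxE !big_ord_recl big_ord0 l1 o0 !mxE /=; ring.
have Fr_real X : (exists v, Fr v = X) <-> X = U *m conj_mx X *m epsH R.
  have colE0 v : col 0 (Fr v) = phi v.
    by apply/matrixP => a j; rewrite ord1 mxE FrE0.
  have colE1 v : col 1 (Fr v) = phi (J2 *m v).
    by apply/matrixP => a j; rewrite ord1 mxE FrE1.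
  have colM (Y : 'M[C]_(2 * n, 2)) a A : (U *m conj_mx Y) a A =
      (U *m conj_mx (col A Y)) a 0.
    by rewrite !mxE; apply: eq_bigr => b _; rewrite !mxE.
  split => [[v <-]|XE].
    apply/matrixP => a; elim/ord2_ind; rewrite epsE colM ?colE0 ?colE1.
      rewrite FrE0 phi_j2 cjM cjK mulmxA UU mulNmx mul1mx [in RHS]mxE.
      by rewrite opprK.
    by rewrite FrE1 phi_j2.
  have [v vX] := P_surj (col 0 X); exists v; apply/matrixP => a; elim/ord2_ind.
    by rewrite FrE0 phiE vX mxE.
  by rewrite FrE1 phi_j2 phiE vX [in RHS]XE epsE colM.
have sE (s : 'M[C]_2) v a A : (Fr v *m s^T) a A =
    phi v a 0 * s A 0 + phi (J2 *m v) a 0 * s A 1.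
  by rewrite mxE !big_ord_recl big_ord0 l1 o0 addr0 FrE0 FrE1 !mxE.
(* On H the element x J1 + y J2 + z J3 acts by the matrix with rows (i x, y + i z) and (- y + i z, -
   i x), the general element of sp(1). *)
have FrJ x y z v (K := x *: J1 + y *: J2 + z *: J3) (s : 'M[C]_2) :
    s 0 0 = Complex 0 x -> s 0 1 = Complex y z ->
    s 1 0 = Complex (- y) z -> s 1 1 = Complex 0 (- x) ->
    Fr (K *m v) = Fr v *m s^T.
  move=> s00 s01 s10 s11.
  have KE : K *m v = x *: (J1 *m v) + (y *: (J2 *m v) + (z *: (J1 *m (J2 *m v)) + 0)).
    by rewrite /K !mulmxDl -!scalemxAl addr0 mulmxA J12 addrA.
  have phiJJ : phi (J2 *m (J1 *m v)) = - ('i%C *: phi (J2 *m v)).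
    by rewrite mulmxA J21 -J12 mulNmx -mulmxA -scaleN1r -[X in phi X]addr0 phi_lin
       phi0 addr0 phi_j1 rmorphN1 scaleN1r.
  have J2J2 u : J2 *m (J2 *m u) = - u by rewrite mulmxA J22 mulNmx mul1mx.
  have phiN u : phi (- u) = - phi u.
    by rewrite -scaleN1r -[X in phi X]addr0 phi_lin phi0 addr0 rmorphN1 scaleN1r.
  have J2J1J2 : J2 *m (J1 *m (J2 *m v)) = J1 *m v.
    by rewrite mulmxA J21 -J12 mulNmx -mulmxA J2J2 mulmxN opprK.
  have i1 r : Complex 0 r = 'i%C * r%:C :> C.
    by rewrite [LHS]complexE [X in X + _](_ : _ = 0) ?add0r.
  have ir r t : Complex r t = r%:C + 'i%C * t%:C :> C by exact: complexE.
  apply/matrixP => a; elim/ord2_ind; rewrite sE.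
    rewrite FrE0 KE !phi_lin phi0 !phi_j1 s00 s01 (i1 x) (ir y z) !mxE; ring.
  rewrite FrE1 KE !mulmxDr -!scalemxAr mulmx0 J2J2 J2J1J2 !phi_lin phi0 phiJJ phiN phi_j1.
  rewrite s10 s11 (i1 (- x)) (ir (- y) z) !mxE !rmorphN /=; ring.
have Fr_quat K : q K <-> exists2 s, sp1 s & forall v, Fr (K *m v) = Fr v *m s^T.
  split.
    move=> /qE [x [y [z KE]]].
    pose s : 'M[C]_2 := \matrix_(i, j) (if i == 0 then if j == 0 then Complex 0 x else
      Complex y z else if j == 0 then Complex (- y) z else Complex 0 (- x)).
    exists s; last by move=> v; rewrite KE; apply: FrJ; rewrite mxE.
    split; first by rewrite /mxtrace !big_ord_recl big_ord0 l1 o0 !mxE /= addr0;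
      apply/eqP; rewrite eq_complex /= addr0 subrr !eqxx.
    apply/matrixP => i j; rewrite !mxE; apply/eqP; rewrite eq_complex.
    by elim/ord2_ind: i; elim/ord2_ind: j; rewrite /= ?oppr0 ?opprK !eqxx.
  move=> [s [s_tr /matrixP s_herm] sF].
  have s11 : s 1 1 = - s 0 0.
    move: s_tr; rewrite /mxtrace !big_ord_recl big_ord0 l1 o0 addr0 => /eqP.
    by rewrite addrC addr_eq0 => /eqP.
  have := s_herm 0 0; have := s_herm 0 1; rewrite !mxE.
  case s00 : (s 0 0) => [x0 x]; case s01 : (s 0 1) => [y z].
  move=> s10 /eqP; rewrite eq_complex /= => /andP [/eqP x00 _].
  have {}x00 : x0 = 0.
    have /eqP : x0 *+ 2 = 0 by rewrite mulr2n {1}x00 addNr.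
    by rewrite mulrn_eq0 => /eqP.
  pose K' := x *: J1 + y *: J2 + z *: J3.
  have K'F v : Fr (K' *m v) = Fr v *m s^T.
    apply: FrJ; rewrite ?s11 ?s10 ?s00 ?s01 ?x00 //.
      by apply/eqP; rewrite eq_complex /= opprK !eqxx.
    by apply/eqP; rewrite eq_complex /= oppr0 !eqxx.
  apply/qE; exists x, y, z; rewrite -/K'.
  apply/matrixP => i j; have /Fr_inj : Fr (K *m delta_mx j 0) = Fr (K' *m delta_mx j 0).
    by rewrite sF K'F.
  by rewrite -!colE => /matrixP/(_ i 0); rewrite !mxE.
have wE u v : (bil w u v)%:C = ((cx u)^T *m W *m cx v) 0 0 by exact: cx_bil.
have cSWS : (conj_mx S)^T *m W *m conj_mx S = 0.
  by have := congr1 (@conj_mx R _ _) SWS; rewrite !cjM cjT cjR cj0.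
clearbody Fr g j1 j2 W.
have Fr_form u v : (bil w u v)%:C =
    \sum_a \sum_b \sum_A \sum_B g a b * epsH R A B * Fr u a A * Fr v b B.
  have mE (x y : 'cV[C]_(2 * n)) (G : 'M[C]_(2 * n)) :
      (x^T *m G *m y) 0 0 = \sum_a \sum_b G a b * x a 0 * y b 0.
    rewrite -mulmxA mxE; apply: eq_bigr => a _; rewrite !mxE mulr_sumr.
    by apply: eq_bigr => b _; ring.
  (* As w has type (1, 1), it is the pairing of phi u with conj (phi v) by h plus the conjugate
     term; since phi (J2 v) = U conj (phi v), both become values of g. *)
  transitivity (((phi u)^T *m g *m phi (J2 *m v)) 0 0 -
                ((phi (J2 *m u))^T *m g *m phi v) 0 0).
    have e1 x y : x^T *m g *m (U *m y) = x^T *m h *m y.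
      by rewrite mulmxA -(mulmxA _ g) gU.
    have e2 x y : (U *m x)^T *m g *m y = - (x^T *m conj_mx h *m y).
      by rewrite trmx_mul -(mulmxA _ U^T) Ug mulmxN mulNmx.
    rewrite wE (vE u) (vE v) (isotropic_sum_form _ _ _ _ SWS cSWS) -hE -ch.
    by rewrite !phi_j2 e1 e2 mxE [X in _ = _ - X]mxE opprK.
  rewrite !mE -sumrB; apply: eq_bigr => a _; rewrite -sumrB; apply: eq_bigr => b _.
  rewrite !big_ord_recl !big_ord0 l1 o0 !FrE0 !FrE1 !mxE /=; ring.
exact: (inhabits (EHFrame g_sym g_unit UU quat_metric Fr_lin Fr_inj Fr_real Fr_quat Fr_form)).
Qed.

End FrameExistence.

(** * The Pfaffian and the volume form *)

Section Pfaffian.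
Variables (K : comNzRingType) (n : nat).
Local Notation I := 'I_(4 * n).
Local Notation ev i := (pair_index i false).
Local Notation od i := (pair_index i true).

(** For a skew matrix, 2^(2n) (2n)! times the Pfaffian: each perfect matching is counted for every
    order of its pairs and of the two members of each pair. *)
Definition pf (A : 'M[K]_(4 * n)) : K :=
  \sum_(s : 'S_(4 * n)) (-1) ^+ s * \prod_(i < 2 * n) A (s (ev i)) (s (od i)).

Lemma pair_index_inj (i j : 'I_(2 * n)) b c :
  pair_index i b = pair_index j c -> i = j /\ b = c.
Proof.
move=> /(congr1 val) /= h.
have bc : b = c by move/(congr1 odd): h; rewrite !oddD !odd_double; case: b; case: c.
by split=> //; apply: val_inj; move: h; rewrite bc => /addIn /double_inj.
Qed.

Lemma pair_index_surj (k : I) : exists i b, k = pair_index i b.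
Proof.
have lt : (k./2 < 2 * n)%N.
  by rewrite ltn_half_double -mul2n mulnA; apply: leq_trans (ltn_ord k) _.
exists (Ordinal lt), (odd k); apply: val_inj => /=.
by rewrite -[LHS]odd_double_half addnC.
Qed.

Lemma pair_index_bij : bijective (fun p : 'I_(2 * n) * bool => pair_index p.1 p.2).
Proof.
apply: inj_card_bij.
  by move=> [i b] [j c] /pair_index_inj [/= -> ->].
by rewrite card_prod card_bool !card_ord -mulnA [(n * 2)%N]mulnC mulnA.
Qed.

Lemma big_pair_index (T : Type) (idx : T) (op : Monoid.com_law idx) (f : I -> T) :
  \big[op/idx]_k f k = \big[op/idx]_i op (f (ev i)) (f (od i)).
Proof.
rewrite (reindex _ (onW_bij _ pair_index_bij)) /=.
rewrite -(pair_bigA _ (fun i b => f (pair_index i b))) /=.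
by apply: eq_bigr => i _; rewrite big_bool /= Monoid.mulmC.
Qed.

(** Expanding the entries of B^T A B turns the product over pairs into a sum over all maps f from
    indices to indices. Summed over s, the factors from B form the determinant of the rows f k of B,
    which is 0 for a repeated row and the sign of f times det B for a permutation f. *)
Lemma pf_congruence (A B : 'M[K]_(4 * n)) : pf (B^T *m A *m B) = \det B * pf A.
Proof.
transitivity (\sum_(f : {ffun I -> I}) (\prod_i A (f (ev i)) (f (od i))) *
    \det (\matrix_(k, l) B (f k) l)).
  transitivity (\sum_(s : 'S_(4 * n)) \sum_(f : {ffun I -> I})
      (-1) ^+ s * ((\prod_i A (f (ev i)) (f (od i))) * \prod_k B (f k) (s k))).
    apply: eq_bigr => s _; rewrite -mulr_sumr; congr (_ * _).
    transitivity (\prod_i \sum_(p : I * I) B p.1 (s (ev i)) * A p.1 p.2 * B p.2 (s (od i))).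
      apply: eq_bigr => i _.
      rewrite -(pair_bigA _ (fun p1 p2 => B p1 (s (ev i)) * A p1 p2 * B p2 (s (od i)))) /=.
      rewrite mxE exchange_big; apply: eq_bigr => p2 _; rewrite mxE mulr_suml.
      by apply: eq_bigr => p1 _; rewrite mxE.
    rewrite bigA_distr_bigA /=.
    pose up (f : {ffun I -> I}) : {ffun 'I_(2 * n) -> I * I} :=
      [ffun i => (f (ev i), f (od i))].
    have up_bij : bijective up.
      apply: inj_card_bij.
        move=> f g fg; apply/ffunP => k; have [i [b ->]] := pair_index_surj k.
        by have /ffunP/(_ i) := fg; rewrite !ffunE => -[]; case: b.
      by rewrite !card_ffun card_prod !card_ord mulnn -expnM mulnA.
    rewrite (reindex up) /=; last exact: onW_bij.
    apply: eq_bigr => f _; rewrite (big_pair_index _ (fun k => B (f k) (s k))) -big_split.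
    by apply: eq_bigr => i _; rewrite !ffunE /=; ring.
  rewrite exchange_big; apply: eq_bigr => f _; rewrite /determinant mulr_sumr.
  apply: eq_bigr => s _; rewrite mulrCA; congr (_ * (_ * _)).
  by apply: eq_bigr => k _; rewrite mxE.
rewrite (bigID (fun f : {ffun I -> I} => injectiveb f)) /= [X in _ + X]big1 ?addr0.
  rewrite (reindex (@pval _)) /=; last first.
    pose in_Sn := insubd (1%g : 'S_(4 * n)).
    by exists in_Sn => /= f Uf; first apply: val_inj; apply: insubdK.
  rewrite /pf mulr_sumr; apply: eq_big => [s|s _]; first by rewrite /= (valP s).
  have -> : \matrix_(k, l) B (pval s k) l = row_perm s B.
    by apply/matrixP => k l; rewrite !mxE pvalE.
  rewrite row_permE det_mulmx det_perm mulrC -mulrA [RHS]mulrCA.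
  by congr (_ * (_ * _)); apply: eq_bigr => i _; rewrite !pvalE.
move=> f /injectivePn [k [l nkl fkl]].
rewrite (determinant_alternate nkl) ?mulr0 // => j.
by rewrite !mxE fkl.
Qed.

End Pfaffian.

Section PfaffianStandard.
Variables (K : numDomainType) (n : nat).
Local Notation I := 'I_(4 * n).

(** A transposition of two pairs is a product of two transpositions. *)
Lemma even_block_perm (p : 'S_(2 * n)) : exists2 s : 'S_(4 * n),
  odd_perm s = false & forall i b, s (pair_index i b) = pair_index (p i) b.
Proof.
have [ts -> _] := prod_tpermP p.
exists (\prod_(t <- ts) (tperm (pair_index t.1 false) (pair_index t.2 false) *
                         tperm (pair_index t.1 true) (pair_index t.2 true)))%g.
  elim: ts => [|t ts IH]; first by rewrite big_nil odd_perm1.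
  rewrite big_cons !odd_permM IH !odd_tperm addbF.
  suff E b : (pair_index t.1 b != pair_index t.2 b) = (t.1 != t.2) by rewrite !E addbb.
  by congr negb; apply/eqP/eqP => [/pair_index_inj [] //|->].
move=> i b; elim: ts i => [|t ts IH] i; first by rewrite !big_nil !perm1.
rewrite !big_cons !permM -IH; congr (_ _).
have E c j k l d : tperm (pair_index j c) (pair_index k c) (pair_index l d) =
    pair_index (if d == c then tperm j k l else l) d :> I.
  case: eqP => [->|dc].
    by rewrite (inj_tperm _ _ _ (f := fun x => pair_index x c)) // => x y /pair_index_inj [].
  by rewrite tpermD //; apply/eqP => /pair_index_inj [_ /esym].
by rewrite !E; case: (b).
Qed.

Lemma swap_perm (be : 'I_(2 * n) -> bool) : exists2 s : 'S_(4 * n),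
  (-1) ^+ s = \prod_i (-1) ^+ be i :> K &
  forall i b, s (pair_index i b) = pair_index i (b (+) be i).
Proof.
pose t i := if be i then tperm (pair_index i false) (pair_index i true) else 1%g.
have tE i j b : t i (pair_index j b) = pair_index j (b (+) ((i == j) && be i)).
  rewrite /t; case: ifP => bi; last by rewrite perm1 andbF addbF.
  rewrite andbT; have [<-|/eqP ij] := eqVneq i j.
    by case: b; rewrite ?tpermL ?tpermR.
  rewrite addbF tpermD //; apply/eqP => /pair_index_inj [] //.
suff this : forall r : seq 'I_(2 * n), uniq r -> exists2 s : 'S_(4 * n),
    (-1) ^+ s = \prod_(i <- r) (-1) ^+ be i :> K &
    forall i b, s (pair_index i b) = pair_index i (b (+) ((i \in r) && be i)).
  have [|s s1 s2] := this (index_enum 'I_(2 * n)); first exact: index_enum_uniq.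
  by exists s => // i b; rewrite s2 mem_index_enum.
elim=> [_|j r IH /= /andP [jr ur]].
  by exists 1%g => [|i b]; rewrite ?odd_perm1 ?big_nil ?perm1 ?addbF.
have [s s1 s2] := IH ur; exists (t j * s)%g.
  rewrite odd_permM signr_addb s1 big_cons; congr (_ * _).
  rewrite /t; case: (be j); last by rewrite odd_perm1.
  rewrite odd_tperm; case: eqP => // /pair_index_inj [] //.
move=> i b; rewrite permM tE s2 inE; congr pair_index.
by rewrite -addbA; congr (_ (+) _); have [->|] := eqVneq i j;
   rewrite ?eqxx ?(negPf jr) /= ?addbF // eq_sym => /negPf ->.
Qed.

(** Nothing cancels: a permutation with nonzero product sends pairs to pairs, so it is a permutation
    of pairs, which is even, composed with swaps inside pairs, whose signs are exactly those of the
    entries. Every nonzero term is 1, and the identity contributes one. *)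
Lemma pf_standard_neq0 (A : 'M[K]_(4 * n)) :
  (forall i j b c, A (pair_index i b) (pair_index j c) =
     if (i == j) && (b != c) then (-1) ^+ b else 0) -> pf A != 0.
Proof.
move=> AE; rewrite /pf (bigD1 1%g) //= odd_perm1 mul1r big1 => [|i _]; last first.
  by rewrite !perm1 AE eqxx.
rewrite gt_eqF // ltr_wpDr // sumr_ge0 // => s _.
set t := \prod_(_ < _) _.
have [->|/prodf_neq0 t0] := eqVneq t 0; first by rewrite mulr0.
suff -> : (-1) ^+ s * t = 1 by rewrite ler01.
have ex i : exists p : 'I_(2 * n) * bool, s (pair_index i false) = pair_index p.1 p.2 /\
    s (pair_index i true) = pair_index p.1 (~~ p.2).
  have := t0 i isT.
  have [j [b ->]] := pair_index_surj (s (pair_index i false)).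
  have [k [c ->]] := pair_index_surj (s (pair_index i true)).
  rewrite AE; case: ifP => [/andP [/eqP <- bc] _|]; last by rewrite eqxx.
  by exists (j, b) => /=; split=> //; congr pair_index; move: bc; case: b; case: c.
have [f /all_and2 [f1 f2]] := choice ex.
have f_inj : injective (fun i => (f i).1).
  move=> i j ij; have [bij|bij] := boolP ((f i).2 == (f j).2).
    have : s (pair_index i false) = s (pair_index j false).
      by rewrite !f1 ij (eqP bij).
    by move=> /perm_inj /pair_index_inj [].
  have : s (pair_index i false) = s (pair_index j true).
    by rewrite f1 f2 ij; congr pair_index; move: bij; case: (_.2); case: (_.2).
  by move=> /perm_inj /pair_index_inj [].
have [s1 s1_even s1E] := even_block_perm (perm f_inj).
have [s2 s2_sign s2E] := swap_perm (fun i => (f i).2).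
have sE : s = (s2 * s1)%g.
  apply/permP => k; have [i [b ->]] := pair_index_surj k.
  by rewrite permM s2E s1E permE; case: b; rewrite /= ?addTb ?addFb.
rewrite {1}sE odd_permM s1_even addbF s2_sign -big_split big1 // => i _ /=.
by rewrite f1 f2 AE eqxx /=; case: (_.2); rewrite /= ?expr1 ?mulrNN mulr1.
Qed.

End PfaffianStandard.

(** * The top power of w is a volume form *)

Section VolumeForm.
Variables (R : realType) (n : nat).
Local Notation V := 'cV[R]_(4 * n).
Local Notation C := R[i].
Local Notation cx := (map_mx (real_complex R)).
Variables (q : set 'M[R]_(4 * n)) (w : 'M[R]_(4 * n)) (F : EHframe q w).

Definition cvec (p : V * V) : 'cV[C]_(4 * n) := cx p.1 + 'i%C *: cx p.2.

Lemma cvec_bil a A b B :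
  ((cvec (dual_pair F a A))^T *m cx w *m cvec (dual_pair F b B)) 0 0 =
  metric F a b * epsH R A B.
Proof.
rewrite -(cpl2_cbil F) /cpl2 /cpl /cbil !cx_bil /cvec.
have trD (y z : 'cV[C]_(4 * n)) : (y + z)^T = y^T + z^T by rewrite linearD.
have trZ c (y : 'cV[C]_(4 * n)) : (c *: y)^T = c *: y^T by rewrite linearZ.
rewrite trD trZ !mulmxDl !mulmxDr -!scalemxAl -!scalemxAr.
have E (X Y : 'M[C]_1) : (X + Y) 0 0 = X 0 0 + Y 0 0 by rewrite mxE.
have Z c (X : 'M[C]_1) : (c *: X) 0 0 = c * X 0 0 by rewrite mxE.
by rewrite !E !Z mulrDr.
Qed.

(** The vectors e_i (x) h_0, each paired with the metric dual of e_i tensored with h_1, form a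
    complex symplectic basis for w; [pf_congruence] reduces to the standard matrix. *)
Lemma pf_neq0 : pf w != 0.
Proof.
have [g gK Kg] := @pair_index_bij n.
pose W := cx w; pose G := metric F.
pose Bc (x y : 'cV[C]_(4 * n)) := (x^T *m W *m y) 0 0.
have Bc_sumr (I : finType) (c : I -> C) y x : Bc x (\sum_i c i *: y i) = \sum_i c i * Bc x (y i).
  rewrite /Bc mulmx_sumr summxE; apply: eq_bigr => i _.
  by rewrite -scalemxAr mxE.
have Bc_suml (I : finType) (c : I -> C) y x : Bc (\sum_i c i *: y i) x = \sum_i c i * Bc (y i) x.
  rewrite /Bc linear_sum !mulmx_suml summxE; apply: eq_bigr => i _.
  by rewrite linearZ -!scalemxAl mxE.
pose bv (p : 'I_(2 * n) * bool) : 'cV[C]_(4 * n) :=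
  if p.2 then \sum_c invmx G c p.1 *: cvec (dual_pair F c 1)
  else cvec (dual_pair F p.1 0).
pose B : 'M[C]_(4 * n) := \matrix_(k, l) bv (g l) k 0.
have BE k l : (B^T *m W *m B) k l = Bc (bv (g k)) (bv (g l)).
  have colB m : bv (g m) = B *m delta_mx m 0.
    by rewrite -colE; apply/matrixP => i j; rewrite ord1 !mxE.
  rewrite !colB /Bc trmx_mul trmx_delta !mulmxA -colE -!mulmxA -rowE.
  by rewrite !mxE.
suff pfB : pf (B^T *m W *m B) != 0.
  apply: contra_neq pfB => w0; rewrite pf_congruence.
  suff -> : pf W = (pf w)%:C by rewrite w0 rmorph0 mulr0.
  rewrite /pf rmorph_sum; apply: eq_bigr => s _.
  rewrite rmorphM rmorph_sign; congr (_ * _).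
  by rewrite rmorph_prod; apply: eq_bigr => i _; rewrite mxE.
have dual i j : \sum_c G i c * invmx G c j = (i == j)%:R.
  have := mulmxV (metric_unit F) => /matrixP/(_ i j).
  by rewrite !mxE.
apply: pf_standard_neq0 => i j b c; rewrite BE.
rewrite -[pair_index i b]/((fun p => pair_index p.1 p.2) (i, b)) gK.
rewrite -[pair_index j c]/((fun p => pair_index p.1 p.2) (j, c)) gK /bv /=.
have cvB a A d D : Bc (cvec (dual_pair F a A)) (cvec (dual_pair F d D)) =
  G a d * epsH R A D by exact: cvec_bil.
case: b; case: c; rewrite ?andbF ?andbT /=.
- rewrite Bc_sumr big1 // => c _; rewrite Bc_suml big1 ?mulr0 // => d _.
  by rewrite cvB !mxE /= subrr !mulr0.
- rewrite Bc_suml expr1.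
  transitivity (- \sum_c G j c * invmx G c i).
    rewrite -sumrN; apply: eq_bigr => c _; rewrite cvB !mxE /= (metricC F c j).
    by rewrite /G; ring.
  by rewrite dual eq_sym; case: eqP => _; rewrite ?oppr0.
- rewrite Bc_sumr; transitivity (\sum_c G i c * invmx G c j).
    by apply: eq_bigr => c _; rewrite cvB !mxE /=; ring.
  by rewrite dual; case: eqP => _; rewrite ?expr0.
- by rewrite cvB !mxE /= subrr mulr0.
Qed.

Lemma volE (Y : 'I_(4 * n) -> V) :
  vol w Y = 2 ^- (2 * n) * (\det (\matrix_(i, j) Y j i 0) * pf w).
Proof.
rewrite /vol -pf_congruence; congr (_ * _); apply: eq_bigr => s _; congr (_ * _).
apply: eq_bigr => i _; set B := \matrix_(_, _) _.
have colB m : Y m = B *m delta_mx m 0.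
  by rewrite -colE; apply/matrixP => k j; rewrite ord1 !mxE.
rewrite !colB /bil trmx_mul trmx_delta !mulmxA -colE -!mulmxA -rowE.
by rewrite !mxE.
Qed.

Lemma det_replace_col (K : comNzRingType) (m : nat) (S : 'M[K]_m) i :
  \det (\matrix_(k, l) (if l == i then S k l else (1%:M : 'M[K]_m) k l)) = S i i.
Proof.
set N := \matrix_(_, _) _.
have adj1 : \adj (1%:M : 'M[K]_m) = 1%:M by rewrite -[LHS]mul1mx mul_mx_adj det1.
rewrite (expand_det_col N i) -[RHS](big_kron (fun k => S k i) i).
apply: eq_bigr => k _; rewrite !mxE eqxx; congr (_ * _).
transitivity ((\adj (1%:M : 'M[K]_m)) i k); last by rewrite adj1 mxE eq_sym.
rewrite mxE /cofactor; congr (_ * \det _); apply/matrixP => a b.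
by rewrite !mxE eq_sym (negPf (neq_lift _ _)).
Qed.

(** As a derivation, S multiplies a top-degree form by its trace, and this form is nonzero by
    [pf_neq0]. *)
Lemma trace_of_vol (S : 'M[R]_(4 * n)) :
  \sum_i vol w (fun j => if j == i then S *m delta_mx j 0 else delta_mx j 0) = 0 ->
  \tr S = 0.
Proof.
have -> : \sum_i vol w (fun j => if j == i then S *m delta_mx j 0 else delta_mx j 0) =
    2 ^- (2 * n) * (\tr S * pf w).
  rewrite /mxtrace mulr_suml mulr_sumr; apply: eq_bigr => i _.
  rewrite volE -[S i i]det_replace_col; congr (_ * (\det _ * _)).
  apply/matrixP => k l; rewrite !mxE; case: ifP => _.
    by rewrite -colE mxE.
  by rewrite !mxE andbT.
move/eqP; rewrite mulf_eq0 invr_eq0 expf_eq0 pnatr_eq0 andbF /=.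
by rewrite mulf_eq0 (negPf pf_neq0) orbF => /eqP.
Qed.

End VolumeForm.

(** * Smooth functions *)

Section Germs.
Variables (R : realType) (V W : normedModType R).
Implicit Types (f g h : V -> W) (x v : V).

Lemma germ0_differentiable h x : (\forall y \near x, h y = 0) -> differentiable h x.
Proof.
move=> h0.
have hx : h x = 0 by apply: (nbhs_singleton h0).
have h0' : \forall e \near 0, h (x + e) = 0 by apply/(nbhs0P [set y | h y = 0] x).
have [c0 hE] : continuous (\0 : V -> W) /\ h \o shift x = cst (h x) + \0 +o_ 0 id.
  split; first exact: cst_continuous.
  apply/eqaddoE; rewrite hx; apply/eqaddoP => _/posnumP[e].
  near=> y.
  rewrite /= -[(_ - _) y]/(h (y + x) - (0 + 0)) addr0 subr0.
  have -> : h (y + x) = 0 by rewrite addrC; near: y.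
  by rewrite normr0 mulr_ge0.
have d0 : 'd h x = \0 :> (V -> W) by apply: diff_unique.
by apply/diff_locallyP; rewrite d0.
Unshelve. all: by end_near.
Qed.

(** [g] differs from [f] by a function with zero germ. *)
Lemma germ_differentiable f g x : (\forall y \near x, f y = g y) ->
  differentiable f x -> differentiable g x.
Proof.
move=> fg df; have -> : g = f + (g - f) by rewrite addrC subrK.
apply: differentiableD => //; apply: germ0_differentiable.
by apply: filterS fg => y fy; rewrite -[LHS]/(g y - f y) fy subrr.
Qed.

End Germs.

Section Smooth.
Variable R : realType.

(** Smoothness truncated at order k, for proofs of closure properties by induction on the order;
    [smooth_on] is the conjunction over k. *)
Fixpoint diff_upto (V W : normedModType R) k (A : set V) (f : V -> W) : Prop :=
  if k is k'.+1 then (forall p, A p -> differentiable f p) /\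
    forall v, diff_upto k' A ('D_v f)
  else forall p, A p -> differentiable f p.

Section General.
Variables (V W : normedModType R).
Implicit Types (A B : set V) (f g : V -> W).

Lemma smooth_onP A f : smooth_on A f <-> forall k, diff_upto k A f.
Proof.
split.
  move=> sf k; elim: k f sf => [|k IH] f sf; first by move=> p Ap; exact: (sf [::] p Ap).
  split=> [p Ap|v]; first exact: (sf [::] p Ap).
  apply: IH => vs p Ap; have := sf (rcons vs v) p Ap.
  by rewrite foldr_rcons.
move=> kf vs; elim/last_ind: vs f kf => [|vs v IH] f kf p Ap.
  exact: (kf 0%N p Ap).
rewrite foldr_rcons; apply: IH => // k.
by have [_] := kf k.+1; apply.
Qed.

Lemma smooth_on_diff A f p : smooth_on A f -> A p -> differentiable f p.
Proof. by move=> sf; apply: (sf [::]). Qed.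

Lemma smooth_on_derive A f v : smooth_on A f -> smooth_on A ('D_v f).
Proof.
by move=> /smooth_onP sf; apply/smooth_onP => k; have [_] := sf k.+1; apply.
Qed.

Lemma diff_uptoW k A f : diff_upto k.+1 A f -> diff_upto k A f.
Proof.
elim: k f => [|k IH] f [fA fD]; first by [].
by split=> // v; apply: IH; apply: fD.
Qed.

Lemma open_germ A f g p : open A -> A p -> (forall x, A x -> f x = g x) ->
  \forall y \near p, f y = g y.
Proof. by move=> oA Ap fg; apply: filterS (open_nbhs_nbhs (conj oA Ap)). Qed.

Lemma diff_upto_eq k A f g : open A -> (forall x, A x -> f x = g x) ->
  diff_upto k A f -> diff_upto k A g.
Proof.
move=> oA; elim: k f g => [|k IH] f g fg /=.
  move=> fA p Ap; apply: germ_differentiable (fA p Ap); exact: open_germ fg.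
move=> [fA fD]; split=> [p Ap|v].
  by apply: germ_differentiable (fA p Ap); apply: open_germ fg.
apply: IH (fD v) => p Ap; apply: near_eq_derive; exact: open_germ fg.
Qed.

Lemma diff_upto_add k A f g : open A -> diff_upto k A f -> diff_upto k A g ->
  diff_upto k A (fun x => f x + g x).
Proof.
move=> oA; elim: k f g => [|k IH] f g /=.
  by move=> fA gA p Ap; apply: differentiableD; auto.
move=> [fA fD] [gA gD]; split=> [p Ap|v]; first by apply: differentiableD; auto.
apply: diff_upto_eq (IH _ _ (fD v) (gD v)) => // p Ap.
by rewrite -[RHS]/('D_v (f + g) p) deriveD //; apply: diff_derivable; auto.
Qed.

Lemma diff_upto_cst k A (c : W) : diff_upto k A (cst c).
Proof.
elim: k c => [|k IH] c /=; first by move=> p _; apply: differentiable_cst.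
split=> [p _|v]; first exact: differentiable_cst.
have -> : 'D_v (cst c) = cst 0 :> (V -> W) by apply/funext => p; rewrite derive_cst.
exact: IH.
Qed.

End General.

Section Scalar.
Variable V : normedModType R.
Implicit Types (A : set V) (f g : V -> R).

Lemma diff_upto_mul k A f g : open A -> diff_upto k A f -> diff_upto k A g ->
  diff_upto k A (fun x => f x * g x).
Proof.
move=> oA; elim: k f g => [|k IH] f g /=.
  by move=> fA gA p Ap; apply: differentiableM; auto.
move=> fk gk; have [fA fD] := fk; have [gA gD] := gk.
split=> [p Ap|v]; first by apply: differentiableM; auto.
have := diff_upto_add oA (IH _ _ (diff_uptoW fk) (gD v)) (IH _ _ (diff_uptoW gk) (fD v)).
apply: diff_upto_eq => // p Ap.
by rewrite -[RHS]/('D_v (f * g) p) deriveM //; apply: diff_derivable; auto.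
Qed.

Lemma diff_upto_sum k A n (f : 'I_n -> V -> R) : open A ->
  (forall i, diff_upto k A (f i)) -> diff_upto k A (fun x => \sum_i f i x).
Proof.
move=> oA; elim: n f => [|n IH] f fk.
  apply: diff_upto_eq (diff_upto_cst k A 0) => // x _.
  by rewrite big_ord0.
apply: diff_upto_eq (diff_upto_add oA (fk ord0) (IH _ (fun i => fk (lift ord0 i)))) => //.
by move=> x _; rewrite big_ord_recl.
Qed.

End Scalar.

Section Coordinates.
Variables (V : normedModType R) (m : nat).
Implicit Types (A : set V) (f : V -> 'cV[R]_m).

Lemma differentiable_entryP f p :
  differentiable f p <-> forall i, differentiable (fun x => f x i 0) p.
Proof.
split=> [fd i|fd].
  exact: (differentiable_comp fd (differentiable_coord (f p) i 0)).
have -> : f = \sum_(i < m) (fun x => f x i 0 *: (delta_mx i 0 : 'cV[R]_m)).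
  apply/funext => x; rewrite fct_sumE {1}[f x]matrix_sum_delta.
  by apply: eq_bigr => i _; rewrite big_ord1.
by apply: differentiable_sum => i; apply: differentiableZl.
Qed.

Lemma derive_entry f p v i : differentiable f p ->
  ('D_v f p) i 0 = 'D_v (fun x => f x i 0) p.
Proof.
move=> fd.
have fE : f = \sum_(i < m) (fun x => f x i 0 *: (delta_mx i 0 : 'cV[R]_m)).
  apply/funext => x; rewrite fct_sumE {1}[f x]matrix_sum_delta.
  by apply: eq_bigr => k _; rewrite big_ord1.
have di j := (differentiable_entryP f p).1 fd j.
have dZ j : differentiable (fun x => f x j 0 *: (delta_mx j 0 : 'cV[R]_m)) p.
  exact: differentiableZl.
rewrite {1}fE derive_sum; last by move=> j; apply: diff_derivable.
rewrite summxE (bigD1 i) //= big1 ?addr0 => [|j ji]; rewrite deriveE // diffZl //.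
  by rewrite !mxE !eqxx mulr1 -deriveE.
by rewrite !mxE eq_sym (negPf ji) mulr0.
Qed.

Lemma diff_upto_entryP k A f : open A ->
  (diff_upto k A f <-> forall i, diff_upto k A (fun x => f x i 0)).
Proof.
move=> oA; elim: k f => [|k IH] f /=.
  split=> [fA i p Ap|fA p Ap]; first exact: (differentiable_entryP f p).1 (fA p Ap) i.
  by apply/differentiable_entryP => i; apply: fA.
split=> [[fA fD] i|fi].
  split=> [p Ap|v]; first exact: (differentiable_entryP f p).1 (fA p Ap) i.
  apply: diff_upto_eq ((IH _).1 (fD v) i) => // p Ap.
  by rewrite derive_entry //; apply: fA.
have fA p : A p -> differentiable f p.
  by move=> Ap; apply/differentiable_entryP => i; apply: (fi i).1.
split=> // v; apply/IH => i.
by apply: diff_upto_eq ((fi i).2 v) => // p Ap; rewrite derive_entry //; apply: fA.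
Qed.

End Coordinates.

Section Composition.
Variables (V : normedModType R) (m : nat).
Local Notation T := 'cV[R]_m.

Lemma derive_comp (W : normedModType R) (psi : V -> T) (g : T -> W) p v :
  differentiable psi p -> differentiable g (psi p) ->
  'D_v (g \o psi) p = 'D_('D_v psi p) g (psi p).
Proof.
move=> dp dg; have dc := differentiable_comp dp dg.
by rewrite !deriveE // diff_comp.
Qed.

Lemma derive_sum_dir (W : normedModType R) (g : T -> W) p u : differentiable g p ->
  'D_u g p = \sum_i u i 0 *: 'D_(delta_mx i 0) g p.
Proof.
move=> dg; rewrite deriveE // {1}[u]matrix_sum_delta linear_sum.
by apply: eq_bigr => i _; rewrite big_ord1 linearZ deriveE.
Qed.

(** The chain rule in coordinates: a derivative of the composite is a sum of products of an entry of
    D_v psi with a partial derivative of g composed with psi, to which the induction hypothesis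
    applies. *)
Lemma diff_upto_comp k (A : set V) (B : set T) (psi : V -> T) (g : T -> R) :
  open A -> (forall x, A x -> B (psi x)) ->
  diff_upto k A psi -> diff_upto k B g -> diff_upto k A (g \o psi).
Proof.
move=> oA AB; elim: k g => [|k IH] g.
  by move=> pA gB p Ap; apply: differentiable_comp; [apply: pA|apply/gB/AB].
move=> pk gk; have [pA pD] := pk; have [gB gD] := gk.
split=> [p Ap|v]; first by apply: differentiable_comp; [apply: pA|apply/gB/AB].
have Sk i : diff_upto k A (fun p => 'D_v psi p i 0 * 'D_(delta_mx i 0) g (psi p)).
  apply: diff_upto_mul => //; first exact: ((diff_upto_entryP k ('D_v psi) oA).1 (pD v) i).
  exact: IH (diff_uptoW pk) (gD _).
apply: diff_upto_eq (diff_upto_sum oA Sk) => // p Ap.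
by rewrite derive_comp ?derive_sum_dir //; [apply/gB/AB|apply: pA|apply/gB/AB].
Qed.

End Composition.

Section SmoothClosure.
Variables (V : normedModType R) (m : nat).
Implicit Types (A : set V).

Lemma smooth_on_eq (W : normedModType R) A (f g : V -> W) :
  open A -> (forall x, A x -> f x = g x) -> smooth_on A f -> smooth_on A g.
Proof.
by move=> oA fg /smooth_onP sf; apply/smooth_onP => k; apply: diff_upto_eq (sf k).
Qed.

Lemma smooth_on_sub (W : normedModType R) A B (f : V -> W) :
  B `<=` A -> smooth_on A f -> smooth_on B f.
Proof. by move=> BA sf vs p /BA; apply: sf. Qed.

Lemma smooth_on_add (W : normedModType R) A (f g : V -> W) :
  open A -> smooth_on A f -> smooth_on A g -> smooth_on A (fun x => f x + g x).
Proof.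
move=> oA /smooth_onP sf /smooth_onP sg; apply/smooth_onP => k.
exact: diff_upto_add.
Qed.

Lemma smooth_on_cst (W : normedModType R) A (c : W) : smooth_on A (fun _ : V => c).
Proof. by apply/smooth_onP => k; apply: diff_upto_cst. Qed.

Lemma smooth_on_entryP A (f : V -> 'cV[R]_m) : open A ->
  (smooth_on A f <-> forall i, smooth_on A (fun x => f x i 0)).
Proof.
move=> oA; split=> [/smooth_onP sf i|sf]; apply/smooth_onP => k.
  exact: ((diff_upto_entryP k f oA).1 (sf k) i).
by apply/(diff_upto_entryP k f oA) => i; have /smooth_onP := sf i.
Qed.

Lemma smooth_on_scale A (f : V -> R) (g : V -> 'cV[R]_m) :
  open A -> smooth_on A f -> smooth_on A g -> smooth_on A (fun x => f x *: g x).
Proof.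
move=> oA /smooth_onP sf /(smooth_on_entryP _ oA) sg; apply/smooth_on_entryP => // i.
apply/smooth_onP => k; have /smooth_onP := sg i => sgi.
apply: diff_upto_eq (diff_upto_mul oA (sf k) (sgi k)) => // x _.
by rewrite mxE.
Qed.

Lemma smooth_on_comp p A (B : set 'cV[R]_p) (psi : V -> 'cV[R]_p) (g : 'cV[R]_p -> R) :
  open A -> (forall x, A x -> B (psi x)) ->
  smooth_on A psi -> smooth_on B g -> smooth_on A (g \o psi).
Proof.
move=> oA AB /smooth_onP sp /smooth_onP sg; apply/smooth_onP => k.
exact: diff_upto_comp AB (sp k) (sg k).
Qed.

End SmoothClosure.

Lemma smooth_on_compv (V : normedModType R) m p (A : set V) (B : set 'cV[R]_p)
    (psi : V -> 'cV[R]_p) (g : 'cV[R]_p -> 'cV[R]_m) :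
  open A -> open B -> (forall x, A x -> B (psi x)) ->
  smooth_on A psi -> smooth_on B g -> smooth_on A (g \o psi).
Proof.
move=> oA oB AB sp /(smooth_on_entryP _ oB) sg; apply/smooth_on_entryP => // i.
exact: (smooth_on_comp oA AB sp (sg i)).
Qed.

End Smooth.

(** * Vector fields and connections *)

Section Manifold.
Variables (R : realType) (m : nat) (M : manifold R m).
Local Notation V := 'cV[R]_m.
Implicit Types (c : chart R M m) (U : set M) (x y : M).

Lemma chart_img_open c U : open U -> open (c @` (U `&` dom c)).
Proof.
move=> oU; rewrite openE => _ [x [Ux cx] <-].
have img : (c @` dom c) (c x) by exists x.
have := @inv_cont _ _ _ c; rewrite continuous_open_subspace; last exact: img_open.
move=> /(_ (c x)); rewrite inE => /(_ img) icont.
have nU : nbhs (inv c (c x)) U by rewrite fwdK //; apply: open_nbhs_nbhs.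
have nI : nbhs (c x) (c @` dom c).
  by apply: open_nbhs_nbhs; split=> //; apply: img_open.
apply: filterS (filterI nI (icont _ nU)) => p [[y cy <-]] /=.
by rewrite /preimage /= fwdK // => Uy; exists y.
Qed.

Lemma chart_img_near c U x : open U -> U x -> dom c x ->
  \forall p \near c x, (c @` (U `&` dom c)) p.
Proof.
move=> oU Ux cx; apply: open_nbhs_nbhs; split; first exact: chart_img_open.
by exists x.
Qed.

Lemma atlas_chart_at x : atlas (chart_at x). Proof. exact: chart_at_atlas. Qed.

Lemma transition_smooth c c0 : atlas c -> atlas c0 ->
  smooth_on (c0 @` (dom c `&` dom c0)) (c \o inv c0).
Proof. by move=> ac ac0; rewrite setIC; apply: atlas_smooth. Qed.

Lemma transition_diff c c0 y : atlas c -> atlas c0 -> dom c y -> dom c0 y ->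
  differentiable (c \o inv c0) (c0 y).
Proof.
move=> ac ac0 cy c0y; apply: smooth_on_diff (transition_smooth ac ac0) _.
by exists y.
Qed.

Definition tangent_map c y (v : V) : V := 'D_v (c \o inv (chart_at y)) (chart_at y y).

Lemma tangent_map_linear c y a (u v : V) : atlas c -> dom c y ->
  tangent_map c y (a *: u + v) = a *: tangent_map c y u + tangent_map c y v.
Proof.
move=> ac cy; have d := transition_diff ac (atlas_chart_at y) cy (chart_at_dom y).
by rewrite /tangent_map !deriveE // linearP.
Qed.

(** Chain rule for the cocycle identity of transition maps, which holds only near c0 y. *)
Lemma derive_transition c c1 c0 y (v : V) : atlas c -> atlas c1 -> atlas c0 ->
  dom c y -> dom c1 y -> dom c0 y ->
  'D_('D_v (c1 \o inv c0) (c0 y)) (c \o inv c1) (c1 y) = 'D_v (c \o inv c0) (c0 y).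
Proof.
move=> ac ac1 ac0 cy c1y c0y.
have d1 := transition_diff ac1 ac0 c1y c0y.
have d2 := transition_diff ac ac1 cy c1y.
have c1E : (c1 \o inv c0) (c0 y) = c1 y by rewrite /= fwdK.
have d2' : differentiable (c \o inv c1) ((c1 \o inv c0) (c0 y)) by rewrite c1E.
rewrite -[in LHS]c1E -(derive_comp v d1 d2').
apply: near_eq_derive.
have oU : open (dom c `&` dom c1) by apply: openI; apply: dom_open.
apply: filterS (chart_img_near oU (conj cy c1y) c0y) => _ [z [[cz c1z] c0z] <-] /=.
by rewrite !fwdK.
Qed.

Lemma derive_chart_id c y (v : V) : dom c y -> 'D_v (c \o inv c) (c y) = v.
Proof.
move=> cy; transitivity ('D_v (id : V -> V) (c y)); last by rewrite derive_id.
apply: near_eq_derive.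
apply: filterS (chart_img_near openT I cy) => _ [z [_ cz] <-] /=.
by rewrite fwdK.
Qed.

Lemma chart_coord_change c c0 (X : M -> V) y : atlas c -> atlas c0 ->
  dom c y -> dom c0 y ->
  chart_coord c X y = 'D_(chart_coord c0 X y) (c \o inv c0) (c0 y).
Proof.
move=> ac ac0 cy c0y; rewrite /chart_coord derive_transition //.
- exact: atlas_chart_at.
- exact: chart_at_dom.
Qed.

Lemma chart_coord_self (X : M -> V) y : chart_coord (chart_at y) X y = X y.
Proof. exact: derive_chart_id (chart_at_dom y). Qed.

(* The field with constant coordinates v in the chart c0. *)
Definition const_field c0 (v : V) y : V := 'D_v (chart_at y \o inv c0) (c0 y).

Lemma chart_coord_const c c0 v y : atlas c -> atlas c0 -> dom c y -> dom c0 y ->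
  chart_coord c (const_field c0 v) y = 'D_v (c \o inv c0) (c0 y).
Proof.
move=> ac ac0 cy c0y; rewrite /chart_coord derive_transition //.
- exact: atlas_chart_at.
- exact: chart_at_dom.
Qed.

Lemma const_field_at x v : const_field (chart_at x) v x = v.
Proof. exact: derive_chart_id (chart_at_dom x). Qed.

(** In a chart c the coordinates are the derivative along v of the transition map from c0 to c,
    composed with the transition map from c to c0. *)
Lemma smooth_field_const c0 v : atlas c0 -> smooth_field (dom c0) (const_field c0 v).
Proof.
move=> ac0 c ac.
have oc := dom_open c; have oc0 := dom_open c0.
have o1 : open (c @` (dom c0 `&` dom c)) by apply: chart_img_open.
have o2 : open (c0 @` (dom c `&` dom c0)) by apply: chart_img_open.
have s1 := transition_smooth ac0 ac.
have s2 := smooth_on_derive v (transition_smooth ac ac0).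
have AB p : (c @` (dom c0 `&` dom c)) p -> (c0 @` (dom c `&` dom c0)) ((c0 \o inv c) p).
  by move=> [y [c0y cy] <-]; exists y => //=; rewrite fwdK.
apply: (smooth_on_eq o1 _ (smooth_on_compv o1 o2 AB s1 s2)).
move=> _ [y [c0y cy] <-] /=; rewrite (fwdK cy).
exact (esym (chart_coord_const v ac ac0 cy c0y)).
Qed.

Lemma field_at_const x v : field_at x (const_field (chart_at x) v).
Proof.
exists (dom (chart_at x)); split; [exact: dom_open|exact: chart_at_dom|].
exact: smooth_field_const (atlas_chart_at x).
Qed.

(** Lets an identity between local fields be read as one between tangent vectors at x. *)
Lemma field_through x (v : V) : exists2 X, field_at x X & X x = v.
Proof.
by exists (const_field (chart_at x) v); [apply: field_at_const|apply: const_field_at].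
Qed.

Lemma smooth_field_sub U U' X : U' `<=` U -> smooth_field U X -> smooth_field U' X.
Proof.
move=> UU sX c ac; apply: smooth_on_sub (sX c ac) => _ [y [Uy cy] <-].
by exists y => //; split=> //; apply: UU.
Qed.

Lemma smooth_fun_sub U U' (f : M -> R) : U' `<=` U -> smooth_fun U f -> smooth_fun U' f.
Proof.
move=> UU sX c ac; apply: smooth_on_sub (sX c ac) => _ [y [Uy cy] <-].
by exists y => //; split=> //; apply: UU.
Qed.

Definition addf (X Y : M -> V) : M -> V := fun y => X y + Y y.

Definition scalef (f : M -> R) (X : M -> V) : M -> V := fun y => f y *: X y.

Lemma smooth_field_add U X Y : open U -> smooth_field U X -> smooth_field U Y ->
  smooth_field U (addf X Y).
Proof.
move=> oU sX sY c ac.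
have oc : open (c @` (U `&` dom c)) by apply: chart_img_open.
apply: smooth_on_eq (smooth_on_add oc (sX c ac) (sY c ac)) => // _ [y [Uy cy] <-] /=.
have := tangent_map_linear 1 (X y) (Y y) ac cy.
by rewrite !scale1r fwdK // => <-.
Qed.

Lemma smooth_field_scale U f X : open U -> smooth_fun U f -> smooth_field U X ->
  smooth_field U (scalef f X).
Proof.
move=> oU sf sX c ac.
have oc : open (c @` (U `&` dom c)) by apply: chart_img_open.
apply: smooth_on_eq (smooth_on_scale oc (sf c ac) (sX c ac)) => // _ [y [Uy cy] <-] /=.
rewrite fwdK // /chart_coord -/(tangent_map c y _) -/(tangent_map c y _).
have t0 : tangent_map c y 0 = 0 by rewrite /tangent_map derive0.
by have := tangent_map_linear (f y) (X y) 0 ac cy; rewrite addr0 t0 addr0.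
Qed.

Lemma field_at_add x X Y : field_at x X -> field_at x Y ->
  field_at x (addf X Y).
Proof.
move=> [U [oU Ux sX]] [U' [oU' Ux' sY]]; exists (U `&` U').
have oI : open (U `&` U') by apply: openI.
split; [exact: oI|by split|apply: (smooth_field_add oI)].
  exact (smooth_field_sub (@subIsetl _ _ _) sX).
exact (smooth_field_sub (@subIsetr _ _ _) sY).
Qed.

Lemma field_at_scale x f X : fun_at x f -> field_at x X ->
  field_at x (scalef f X).
Proof.
move=> [U [oU Ux sX]] [U' [oU' Ux' sY]]; exists (U `&` U').
have oI : open (U `&` U') by apply: openI.
split; [exact: oI|by split|apply: (smooth_field_scale oI)].
  exact (smooth_fun_sub (@subIsetl _ _ _) sX).
exact (smooth_field_sub (@subIsetr _ _ _) sY).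
Qed.

Lemma smooth_fun_cst U (a : R) : smooth_fun U (fun _ => a).
Proof. by move=> c ac; apply: smooth_on_cst. Qed.

Lemma fun_at_cst x (a : R) : fun_at x (fun _ => a).
Proof. by exists setT; split=> //; [apply: openT|apply: smooth_fun_cst]. Qed.

(** Since [fun_at] only sees a neighbourhood of x, the indicator of an open set can take the place
    of a bump function. *)
Lemma fun_at_indicator x U : open U -> U x -> fun_at x (fun y => (`[< U y >])%:R).
Proof.
move=> oU Ux; exists U; split=> // c ac.
have oc : open (c @` (U `&` dom c)) by apply: chart_img_open.
apply: (smooth_on_eq oc _ (@smooth_fun_cst U 1 c ac)).
by move=> _ [y [Uy cy] <-] /=; rewrite fwdK // asboolT.
Qed.

Lemma dirder_germ x v (f g : M -> R) U : open U -> U x -> (forall y, U y -> f y = g y) ->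
  dirder x v f = dirder x v g.
Proof.
move=> oU Ux fg; apply: near_eq_derive.
apply: filterS (chart_img_near oU Ux (chart_at_dom x)) => _ [y [Uy cy] <-] /=.
by rewrite fwdK // fg.
Qed.

Lemma dirder_cst x v (a : R) : dirder x v (fun _ => a) = 0.
Proof. by rewrite /dirder derive_cst. Qed.

Lemma fun_at_diff x f : fun_at x f ->
  differentiable (f \o inv (chart_at x)) (chart_at x x).
Proof.
move=> [U [oU Ux sf]]; apply: smooth_on_diff (sf _ (atlas_chart_at x)) _.
by exists x => //; split=> //; apply: chart_at_dom.
Qed.

Lemma dirderN x v f : fun_at x f -> dirder x v (fun y => - f y) = - dirder x v f.
Proof.
by move=> ff; rewrite /dirder -deriveN //; apply: diff_derivable; apply: fun_at_diff.
Qed.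

Definition coord_fun c0 (Y : M -> V) i y : R := chart_coord c0 Y y i 0.

Lemma coord_fun_at x Y i : field_at x Y -> fun_at x (coord_fun (chart_at x) Y i).
Proof.
move=> [U [oU Ux sY]]; set c0 := chart_at x; exists (U `&` dom c0).
have ac0 : atlas c0 by apply: atlas_chart_at.
have oc0 := dom_open c0; have oI : open (U `&` dom c0) by apply: openI.
split=> //; first by split=> //; apply: chart_at_dom.
move=> c ac; have oc := dom_open c.
have o1 : open (c @` ((U `&` dom c0) `&` dom c)) by apply: chart_img_open.
have o2 : open (c0 @` (U `&` dom c0)) by apply: chart_img_open.
have s1 : smooth_on (c @` ((U `&` dom c0) `&` dom c)) (c0 \o inv c).
  apply: smooth_on_sub (transition_smooth ac0 ac) => _ [y [[Uy c0y] cy] <-].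
  by exists y.
have s2 := (smooth_on_entryP _ o2).1 (sY c0 ac0) i.
have AB p : (c @` ((U `&` dom c0) `&` dom c)) p ->
    (c0 @` (U `&` dom c0)) ((c0 \o inv c) p).
  by move=> [y [[Uy c0y] cy] <-]; exists y => //=; rewrite fwdK.
apply: (smooth_on_eq o1 _ (smooth_on_comp o1 AB s1 s2)).
by move=> _ [y [[Uy c0y] cy] <-] /=; rewrite !fwdK.
Qed.

Lemma field_decomposition x Y y : dom (chart_at x) y ->
  Y y = \sum_i coord_fun (chart_at x) Y i y *: const_field (chart_at x) (delta_mx i 0) y.
Proof.
move=> c0y; set c0 := chart_at x.
have ac0 : atlas c0 by apply: atlas_chart_at.
rewrite -[LHS]chart_coord_self (chart_coord_change _ _ ac0 _ c0y); last exact: chart_at_dom.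
  by rewrite derive_sum_dir //; apply: transition_diff => //;
    [apply: atlas_chart_at|apply: chart_at_dom].
exact: atlas_chart_at.
Qed.

Lemma field_at0 x : field_at x (fun _ => 0).
Proof.
exists setT; split=> // [|c ac]; first exact: openT.
have oc : open (c @` (setT `&` dom c)) by apply/chart_img_open/openT.
apply: (smooth_on_eq (f := fun=> 0) oc); last exact: smooth_on_cst.
by move=> _ [y [_ cy] <-] /=; rewrite fwdK // /chart_coord derive0.
Qed.

Lemma field_at_sum x (I : finType) (X : I -> M -> V) :
  (forall i, field_at x (X i)) -> field_at x (fun y => \sum_i X i y).
Proof.
move=> fX.
suff : forall r : seq I, field_at x (fun y => \sum_(i <- r) X i y) by apply.
elim=> [|i r IH].
  rewrite [X in field_at _ X](_ : _ = fun=> 0); first exact: field_at0.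
  by apply/funext => y; rewrite big_nil.
have -> : (fun y => \sum_(j <- i :: r) X j y) = addf (X i) (fun y => \sum_(j <- r) X j y).
  by apply/funext => y; rewrite big_cons.
exact (field_at_add (fX i) IH).
Qed.

Section Connections.
Variables (D : M -> V -> (M -> V) -> V) (D_conn : is_connection D).

Lemma conn_addf x v X Y : field_at x X -> field_at x Y ->
  D x v (addf X Y) = D x v X + D x v Y.
Proof. by move=> fX fY; apply: (conn_add D_conn fX fY v). Qed.

Lemma conn_scalef x v f X : fun_at x f -> field_at x X ->
  D x v (scalef f X) = dirder x v f *: X x + f x *: D x v X.
Proof. by move=> ff fX; apply: (conn_leibniz D_conn ff fX v). Qed.

(** For f the indicator of U, f X = f Y everywhere, while the Leibniz rule gives D (f Z) = D Z at x
    because f is 1 near x. *)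
Lemma conn_germ x v (X Y : M -> V) U : field_at x X -> field_at x Y ->
  open U -> U x -> (forall y, U y -> X y = Y y) -> D x v X = D x v Y.
Proof.
move=> fX fY oU Ux XY.
have fI := fun_at_indicator oU Ux; set f := fun y => _ in fI.
have E Z : field_at x Z -> D x v (scalef f Z) = D x v Z.
  move=> fZ; rewrite conn_scalef // (dirder_germ v (g := fun _ => 1) oU Ux).
    by rewrite dirder_cst scale0r add0r /f asboolT // scale1r.
  by move=> y Uy; rewrite /f asboolT.
rewrite -(E _ fX) -(E _ fY); congr (D x v _); apply/funext => y; rewrite /scalef /f.
by case: asboolP => [/XY ->|_] //; rewrite !scale0r.
Qed.

Lemma conn_sum x v (I : finType) (X : I -> M -> V) : (forall i, field_at x (X i)) ->
  D x v (fun y => \sum_i X i y) = \sum_i D x v (X i).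
Proof.
move=> fX.
have f0 := field_at0 x.
have D0 : D x v (fun _ => 0) = 0.
  have := conn_scalef v (fun_at_cst x 0) f0.
  have -> : scalef (fun=> 0) (fun=> 0) = (fun=> 0) by apply/funext => y; rewrite /scalef scale0r.
  by rewrite scaler0 add0r scale0r.
suff : forall r : seq I, field_at x (fun y => \sum_(i <- r) X i y) /\
    D x v (fun y => \sum_(i <- r) X i y) = \sum_(i <- r) D x v (X i).
  by move=> /(_ (index_enum I)) [].
elim=> [|i r [fr IH]].
  have -> : (fun y => \sum_(i <- [::]) X i y) = (fun _ => 0).
    by apply/funext => y; rewrite big_nil.
  by rewrite big_nil.
have -> : (fun y => \sum_(j <- i :: r) X j y) = addf (X i) (fun y => \sum_(j <- r) X j y).
  by apply/funext => y; rewrite big_cons.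
split; first exact (field_at_add (fX i) fr).
by rewrite (conn_addf v (fX i) fr) big_cons IH.
Qed.

End Connections.

(** Expand Y in the coordinate fields of the chart at x: the terms that differentiate the
    coefficients are the same for both connections and cancel. *)
Lemma connection_difference (D D' : M -> V -> (M -> V) -> V) x :
  is_connection D -> is_connection D' ->
  exists A : V -> 'M[R]_m, (forall a u v, A (a *: u + v) = a *: A u + A v) /\
    forall v Y, field_at x Y -> D x v Y - D' x v Y = A v *m Y x.
Proof.
move=> cD cD'; set c0 := chart_at x.
pose E i := const_field c0 (delta_mx i 0).
have fE i : field_at x (E i) by apply: field_at_const.
pose A v : 'M[R]_m := \matrix_(k, i) (D x v (E i) - D' x v (E i)) k 0.
exists A; split=> [a u v|v Y fY].
  apply/matrixP => k i.
  by rewrite !mxE (conn_linear cD) // (conn_linear cD') // !mxE; ring.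
pose f i := coord_fun c0 Y i.
have ff i : fun_at x (f i) by apply: coord_fun_at.
have ffE i : field_at x (scalef (f i) (E i)) := field_at_scale (ff i) (fE i).
have fS : field_at x (fun y => \sum_i scalef (f i) (E i) y) by apply: field_at_sum.
have key D0 : is_connection D0 -> D0 x v Y =
    \sum_i (dirder x v (f i) *: E i x + f i x *: D0 x v (E i)).
  move=> cD0; rewrite (conn_germ cD0 (Y := fun y => \sum_i scalef (f i) (E i) y) v fY fS
    (dom_open c0) (chart_at_dom x)); last by move=> y c0y; apply: field_decomposition.
  rewrite (conn_sum cD0) //; apply: eq_bigr => i _.
  exact (conn_scalef cD0 v (ff i) (fE i)).
rewrite (key D cD) (key D' cD') -sumrB; apply/colP => k; rewrite summxE mxE.
apply: eq_bigr => i _; rewrite [f i x](_ : _ = Y x i 0); last first.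
  by rewrite /f /coord_fun chart_coord_self.
by rewrite !mxE; ring.
Qed.

End Manifold.

(** * The canonical connection *)

Section DifferentialForms.
Variables (R : realType) (m : nat) (M : manifold R m).
Local Notation V := 'cV[R]_m.
Variables (w : M -> 'M[R]_m) (D : M -> V -> (M -> V) -> V).

(** The classical expression of dw by a connection with torsion: each bracket is D_X Y - D_Y X - T
    (X, Y), and the skewness of w regroups the derivative terms into D w. *)
Lemma ext_der_nabla X Y Z x : (forall y u v, bil (w y) u v = - bil (w y) v u) ->
  ext_der w X Y Z x =
    nabla_form D w x (X x) Y Z + nabla_form D w x (Y x) Z X +
    nabla_form D w x (Z x) X Y +
    (bil (w x) (torsion D X Y x) (Z x) + bil (w x) (torsion D Y Z x) (X x) +
     bil (w x) (torsion D Z X x) (Y x)).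
Proof.
move=> w_skew; rewrite /ext_der /nabla_form /torsion.
move: (bracket X Y x) (bracket Y Z x) (bracket Z X x) => b1 b2 b3; rewrite !bilBl.
move: (dirder x (X x) _) (dirder x (Y x) _) (dirder x (Z x) _) => d1 d2 d3.
rewrite (w_skew x (Y x) (D x (X x) Z)) (w_skew x (Z x) (D x (Y x) X)).
by rewrite (w_skew x (X x) (D x (Z x) Y)); ring.
Qed.

Lemma bil_nondegenerate (b : 'M[R]_m) u : b \in unitmx ->
  (forall z, bil b u z = 0) -> u = 0.
Proof.
move=> b_unit bu; apply: trmx_inj; rewrite trmx0 -[LHS](mulmxK b_unit).
suff -> : u^T *m b = 0 by rewrite mul0mx.
apply/rowP => j; have := bu (delta_mx j 0).
by rewrite /bil -colE !mxE.
Qed.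

Lemma derive_bigsum (I : finType) (f : I -> V -> R) p v :
  (forall i, differentiable (f i) p) ->
  differentiable (fun x => \sum_i f i x) p /\
  'D_v (fun x => \sum_i f i x) p = \sum_i 'D_v (f i) p.
Proof.
move=> df.
suff : forall r : seq I, differentiable (fun x => \sum_(i <- r) f i x) p /\
    'D_v (fun x => \sum_(i <- r) f i x) p = \sum_(i <- r) 'D_v (f i) p.
  exact.
elim=> [|i r [dr Dr]].
  have -> : (fun x => \sum_(i <- [::]) f i x) = cst 0 by apply/funext => x; rewrite big_nil.
  by rewrite derive_cst big_nil; split=> //; apply: differentiable_cst.
have -> : (fun x => \sum_(j <- i :: r) f j x) = f i + (fun x => \sum_(j <- r) f j x).
  by apply/funext => x; rewrite big_cons.
split; first exact: differentiableD.
rewrite deriveD; [|exact: diff_derivable|exact: diff_derivable].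
by rewrite big_cons Dr.
Qed.

Lemma derive_prod (n : nat) (f : 'I_n -> V -> R) p v :
  (forall i, differentiable (f i) p) ->
  differentiable (fun x => \prod_i f i x) p /\
  'D_v (fun x => \prod_i f i x) p =
    \sum_i \prod_j (if j == i then 'D_v (f j) p else f j p).
Proof.
elim: n f => [|n IH] f df.
  have -> : (fun x => \prod_(i < 0) f i x) = cst 1.
    by apply/funext => x; rewrite big_ord0.
  by rewrite derive_cst big_ord0; split => //; apply: differentiable_cst.
have -> : (fun x => \prod_i f i x) = f ord0 * (fun x => \prod_i f (lift ord0 i) x).
  by apply/funext => x; rewrite big_ord_recl.
have [dg Dg] := IH (fun i => f (lift ord0 i)) (fun i => df _).
split; first exact: differentiableM.
rewrite deriveM; [|exact: diff_derivable|exact: diff_derivable].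
rewrite Dg [RHS]big_ord_recl big_ord_recl eqxx addrC; congr (_ + _).
  by rewrite [LHS]mulrC; congr (_ * _); apply: eq_bigr => j _.
rewrite [LHS]mulr_sumr; apply: eq_bigr => i _; rewrite big_ord_recl.
by congr (_ * _); apply: eq_bigr => j _; rewrite ?(inj_eq (@lift_inj _ ord0)).
Qed.

End DifferentialForms.

(** * Derivative of the top power of w *)

Section VolumeDerivative.
Variables (R : realType) (n : nat).
Local Notation V := 'cV[R]_(4 * n).

Lemma prod_insert_sum (k : 'I_(2 * n)) (a b : R) (f : 'I_(2 * n) -> R) :
  \prod_i (if i == k then a + b else f i) =
  \prod_i (if i == k then a else f i) + \prod_i (if i == k then b else f i).
Proof.
rewrite (bigD1 k) //= [in RHS](bigD1 k) //= [X in _ = _ + X](bigD1 k) //= !eqxx mulrDl.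
by congr (_ * _ + _ * _); apply: eq_bigr => i /negPf ->.
Qed.

(** In the term of a permutation s the replaced vector occurs in exactly one factor, as its first or
    second argument. Writing a as the image under s of a position in pair k collects both cases in
    factor k. *)
Lemma vol_derivation (w : 'M[R]_(4 * n)) (E Z : 'I_(4 * n) -> V) :
  \sum_a vol w (fun j => if j == a then Z j else E j) =
  2 ^- (2 * n) * \sum_(s : 'S_(4 * n)) (-1) ^+ s * \sum_k \prod_i
    (if i == k then bil w (Z (s (pair_index k false))) (E (s (pair_index k true))) +
                    bil w (E (s (pair_index k false))) (Z (s (pair_index k true)))
     else bil w (E (s (pair_index i false))) (E (s (pair_index i true)))).
Proof.
rewrite /vol -mulr_sumr; congr (_ * _); rewrite exchange_big; apply: eq_bigr => s _.
rewrite -mulr_sumr; congr (_ * _).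
rewrite (reindex_inj (@perm_inj _ s)) big_pair_index; apply: eq_bigr => k _.
have E1 i b j c : (s (pair_index i b) == s (pair_index j c)) = (i == j) && (b == c).
  rewrite (inj_eq perm_inj).
  by apply/eqP/andP => [/pair_index_inj [-> ->]|[/eqP -> /eqP ->]].
rewrite prod_insert_sum; congr (_ + _); apply: eq_bigr => i _; rewrite !E1 andbF andbT;
  by case: eqP => [->|].
Qed.

Variables (M : manifold R (4 * n)) (w : M -> 'M[R]_(4 * n)).

(** The product rule, in the shape of [vol_derivation], so that the two can be compared factor by
    factor. *)
Lemma dirder_vol x v (E : 'I_(4 * n) -> M -> V) (w' : 'I_(4 * n) -> 'I_(4 * n) -> R) :
  smooth_form w -> (forall i, field_at x (E i)) ->
  (forall i j, dirder x v (fun y => bil (w y) (E i y) (E j y)) = w' i j) ->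
  dirder x v (fun y => vol (w y) (E ^~ y)) =
  2 ^- (2 * n) * \sum_(s : 'S_(4 * n)) (-1) ^+ s * \sum_k \prod_i
    (if i == k then w' (s (pair_index k false)) (s (pair_index k true))
     else bil (w x) (E (s (pair_index i false)) x) (E (s (pair_index i true)) x)).
Proof.
move=> sw fE w'E; set p := chart_at x x.
pose f i j (q : 'cV[R]_(4 * n)) : R := bil (w (inv (chart_at x) q)) (E i (inv (chart_at x) q))
  (E j (inv (chart_at x) q)).
have df i j : differentiable (f i j) p by exact: (fun_at_diff (sw _ _ _ (fE i) (fE j))).
have Df i j : 'D_v (f i j) p = w' i j by rewrite -w'E.
have fp i j : f i j p = bil (w x) (E i x) (E j x).
  by rewrite /f /p fwdK //; apply: chart_at_dom.
pose g (s : 'S_(4 * n)) (q : 'cV[R]_(4 * n)) : R :=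
  \prod_i f (s (pair_index i false)) (s (pair_index i true)) q.
have dg s : differentiable (g s) p /\ 'D_v (g s) p = \sum_k \prod_i
    (if i == k then w' (s (pair_index k false)) (s (pair_index k true))
     else bil (w x) (E (s (pair_index i false)) x) (E (s (pair_index i true)) x)).
  have [d Dg] := @derive_prod R (4 * n) _
    (fun i : 'I_(2 * n) => f (s (pair_index i false)) (s (pair_index i true))) p v
    (fun i => df _ _).
  split=> //; rewrite Dg; apply: eq_bigr => k _; apply: eq_bigr => i _.
  by rewrite Df fp; case: eqP => [->|].
have dgs (s : 'S_(4 * n)) : differentiable ((-1) ^+ s *: g s) p.
  by apply: differentiableZ; case: (dg s).
have [dS DS] := derive_bigsum v dgs.
transitivity ('D_v (2 ^- (2 * n) *: (fun q => \sum_(s : 'S_(4 * n)) ((-1) ^+ s *: g s) q)) p).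
  by [].
rewrite deriveZ; last exact: diff_derivable.
rewrite DS; congr (_ * _); apply: eq_bigr => s _.
have [ds Ds] := dg s.
by rewrite deriveZ; [rewrite Ds|apply: diff_derivable].
Qed.

End VolumeDerivative.

(** [S v, J] is the difference of the covariant derivatives of the section J of Q under the two
    connections. *)
Lemma difference_normalizes (R : realType) (n : nat) (M : manifold R (4 * n))
    (Q : M -> set 'M[R]_(4 * n)) (D D' : M -> 'cV[R]_(4 * n) -> (M -> 'cV[R]_(4 * n)) ->
    'cV[R]_(4 * n)) x (S : 'cV[R]_(4 * n) -> 'M[R]_(4 * n)) U J :
  preserves_Q Q D -> preserves_Q Q D' -> (forall K L, Q x K -> Q x L -> Q x (K - L)) ->
  (forall v Y, field_at x Y -> D x v Y - D' x v Y = S v *m Y x) ->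
  open U -> U x -> smooth_end U J -> (forall y, U y -> Q y (J y)) ->
  forall v, Q x (S v *m J x - J x *m S v).
Proof.
move=> DQ D'Q Qsub SE oU Ux sJ QJ v.
have [K QK KE] := DQ U J oU sJ QJ x Ux v.
have [L QL LE] := D'Q U J oU sJ QJ x Ux v.
suff -> : S v *m J x - J x *m S v = K - L by apply: Qsub.
suff E (u : 'cV[R]_(4 * n)) : (S v *m J x - J x *m S v) *m u = (K - L) *m u.
  apply/matrixP => i j; have /matrixP/(_ i 0) := E (delta_mx j 0).
  by rewrite -!colE !mxE.
have [Y fY <-] := field_through x u.
rewrite !mulmxBl -(KE Y fY) -(LE Y fY) -!mulmxA -(SE v _ (sJ x Ux Y fY)) -(SE v Y fY).
rewrite mulmxBr; move: (J x *m D x v Y) (J x *m D' x v Y) (D x v _) (D' x v _) => a b c d.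
by apply/matrixP => i j; rewrite !mxE; ring.
Qed.

Section CanonicalDifference.
Variables (R : realType) (n : nat) (M : manifold R (4 * n)).
Local Notation V := 'cV[R]_(4 * n).
Variables (Q : M -> set 'M[R]_(4 * n)) (w : M -> 'M[R]_(4 * n)).
Variables (D Dv : M -> V -> (M -> V) -> V).
Hypotheses (hQ : almost_quaternionic Q) (hw : scalar_2form Q w).
Hypotheses (cD : is_connection D) (cDv : is_connection Dv).
Hypotheses (Dv_Q : preserves_Q Q Dv) (Dv_vol : preserves_vol w Dv).
Hypothesis D_def : forall x v Y Z, field_at x Y -> field_at x Z ->
  bil (w x) (D x v Y - Dv x v Y) (Z x) = 2^-1 * nabla_form Dv w x v Y Z.

Lemma w_skew x u v : bil (w x) u v = - bil (w x) v u.
Proof. by case: hw. Qed.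

Lemma local_triple x : exists U, [/\ open U, U x & exists J1 J2 J3 : M -> 'M[R]_(4 * n),
  [/\ admissible Q U J1 J2 J3, quaternionic_triple (Q x) (J1 x) (J2 x) (J3 x) &
   forall J, J = J1 \/ J = J2 \/ J = J3 ->
     [/\ smooth_end U J, forall y, U y -> Q y (J y),
       forall y, U y -> J y *m J y = - 1%:M &
       forall y, U y -> forall u v, bil (w y) (J y *m u) (J y *m v) = bil (w y) u v]]].
Proof.
have [U [oU Ux [J1 [J2 [J3 adm]]]]] := hQ x.
exists U; split; [exact oU|exact Ux|exists J1, J2, J3].
have [s1 s2 s3 triple] := adm.
have [_ _ _ w_inv] := hw.
split; [exact adm|exact (triple x Ux)|move=> J JJ].
have inv y : U y -> forall u v, bil (w y) (J y *m u) (J y *m v) = bil (w y) u v.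
  move=> Uy; apply: (w_inv U J1 J2 J3 oU adm y Uy).
  by case: JJ => [->|[->|->]]; [left|right; left|right; right].
have QJ y : U y -> Q y (J y).
  move=> /triple tr.
  by case: JJ => [->|[->|->]];
    [exact: (triple_in1 tr)|exact: (triple_in2 tr)|exact: (triple_in3 tr)].
have JJ1 y : U y -> J y *m J y = - 1%:M.
  by move=> /triple [j1 j2 j3 _ _]; case: JJ => [->|[->|->]].
by split; [case: JJ => [->|[->|->]]|exact QJ|exact JJ1|exact inv].
Qed.

Lemma w_Q_skew x K : Q x K -> forall u v, bil (w x) (K *m u) v = - bil (w x) u (K *m v).
Proof.
have [U [oU Ux [J1 [J2 [J3 [_ tr JP]]]]]] := local_triple x.
apply: (triple_invariant tr) => J JJ.
by case: JJ => [->|[->|->]]; [case: (JP J1)|case: (JP J2)|case: (JP J3)]; auto.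
Qed.

Lemma frame_at x : inhabited (EHframe (Q x) (w x)).
Proof.
have [U [oU Ux [J1 [J2 [J3 [_ tr JP]]]]]] := local_triple x.
have [_ _ w_unit _] := hw.
apply: (frame_exists tr (w_unit x)) => [u v|J JJ]; first exact: w_skew.
by case: JJ => [->|[->|->]]; [case: (JP J1)|case: (JP J2)|case: (JP J3)]; auto.
Qed.

(* The covariant derivative of J anticommutes with J, as J^2 = -1, hence it does
   not contribute to the derivative of w (J Y, J Z) = w (Y, Z). *)
Lemma nabla_form_invariant U J x v Y Z : open U -> U x -> smooth_end U J ->
  (forall y, U y -> Q y (J y)) -> (forall y, U y -> J y *m J y = - 1%:M) ->
  (forall y, U y -> forall a b, bil (w y) (J y *m a) (J y *m b) = bil (w y) a b) ->
  field_at x Y -> field_at x Z ->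
  nabla_form Dv w x v (fun y => J y *m Y y) (fun y => J y *m Z y) =
  nabla_form Dv w x v Y Z.
Proof.
move=> oU Ux sJ QJ J2 Jw fY fZ.
have [K QK KE] := Dv_Q oU sJ QJ Ux v.
have DJ X : field_at x X ->
    Dv x v (fun y => J y *m X y) = J x *m Dv x v X + K *m X x.
  by move=> fX; rewrite -(KE X fX) addrC subrK.
(* Differentiate J (J X) = - X, an identity valid on U only. *)
have KJ X : field_at x X -> K *m (J x *m X x) = - (J x *m (K *m X x)).
  move=> fX; have fJX := sJ x Ux X fX; have fJJX := sJ x Ux _ fJX.
  have fN : field_at x (scalef (fun=> -1) X) := field_at_scale (fun_at_cst x (-1)) fX.
  have := DJ _ fJX; rewrite (conn_germ cDv v fJJX fN oU Ux); last first.
    by move=> y Uy; rewrite mulmxA J2 // mulNmx mul1mx /scalef scaleN1r.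
  rewrite (conn_scalef cDv v (fun_at_cst x (-1)) fX) dirder_cst scale0r add0r scaleN1r.
  rewrite (DJ X fX) mulmxDr mulmxA J2 // mulNmx mul1mx -addrA -[LHS]addr0 => /addrI/esym/eqP.
  by rewrite addrC addr_eq0 => /eqP.
rewrite /nabla_form (DJ Y fY) (DJ Z fZ).
rewrite (dirder_germ v (g := fun y => bil (w y) (Y y) (Z y)) oU Ux); last first.
  by move=> y Uy; rewrite Jw.
rewrite bilDl bilDr !Jw // (w_Q_skew QK) KJ // bilNr opprK.
by rewrite (w_Q_skew (QJ x Ux) (Y x)); ring.
Qed.

Lemma canonical_difference x : exists A : V -> 'M[R]_(4 * n),
  [/\ forall a u v, A (a *: u + v) = a *: A u + A v,
      forall v Y, field_at x Y -> D x v Y - Dv x v Y = A v *m Y x,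
      forall v Y Z, field_at x Y -> field_at x Z ->
        nabla_form Dv w x v Y Z = 2 * bil (w x) (A v *m Y x) (Z x) &
      forall v, S20E (Q x) (w x) (A v)].
Proof.
have [A [A_lin AE]] := connection_difference x cD cDv.
exists A.
have nablaE v Y Z : field_at x Y -> field_at x Z ->
    nabla_form Dv w x v Y Z = 2 * bil (w x) (A v *m Y x) (Z x).
  by move=> fY fZ; rewrite -AE // D_def // mulrA divff ?mul1r // pnatr_eq0.
have [sw _ w_unit _] := hw.
have two0 : (2 : R) != 0 by rewrite pnatr_eq0.
have A_skew v u z : bil (w x) (A v *m u) z = - bil (w x) (A v *m z) u.
  have [Y fY <-] := field_through x u; have [Z fZ <-] := field_through x z.
  apply: (mulfI two0); rewrite mulrN -!nablaE // /nabla_form.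
  have -> : (fun y => bil (w y) (Y y) (Z y)) = (fun y => - bil (w y) (Z y) (Y y)).
    by apply/funext => y; exact (w_skew y (Y y) (Z y)).
  rewrite (dirderN v (sw _ _ _ fZ fY)).
  by rewrite (w_skew x (Dv x v Y)) (w_skew x (Y x)); ring.
split=> // v; split; last exact: A_skew.
  have [F] := frame_at x.
  apply: (trace_of_vol F).
  have [E fE Ex] : exists2 E : 'I_(4 * n) -> M -> V,
      (forall i, field_at x (E i)) & forall i, E i x = delta_mx i 0.
    exists (fun i => const_field (chart_at x) (delta_mx i 0)) => i.
      exact: field_at_const.
    exact: const_field_at.
  (* Since w (A ., .) is skew, 2 w (A y, z) = w (A y, z) + w (y, A z). So the derivative of w (E_i,
     E_j) is obtained by letting A v and Dvol act on both arguments, and the same then holds for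
     w^2n. *)
  have volD : dirder x v (fun y => vol (w y) (E ^~ y)) =
      \sum_a vol (w x) (fun j => if j == a then A v *m E j x else E j x) +
      \sum_a vol (w x) (fun j => if j == a then Dv x v (E j) else E j x).
    rewrite (vol_derivation (w x) (E ^~ x) (fun j => A v *m E j x)).
    rewrite (vol_derivation (w x) (E ^~ x) (fun j => Dv x v (E j))).
    rewrite (dirder_vol (w' := fun i j => bil (w x) (A v *m E i x) (E j x) +
      bil (w x) (E i x) (A v *m E j x) + (bil (w x) (Dv x v (E i)) (E j x) +
      bil (w x) (E i x) (Dv x v (E j)))) sw fE).
      rewrite -mulrDr -big_split /=; congr (_ * _); apply: eq_bigr => s _.
      rewrite -mulrDr -big_split /=; congr (_ * _); apply: eq_bigr => k _.
      exact: prod_insert_sum.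
    move=> i j; have := nablaE v _ _ (fE i) (fE j); rewrite /nabla_form.
    have -> : bil (w x) (E i x) (A v *m E j x) = bil (w x) (A v *m E i x) (E j x).
      by rewrite (w_skew x (E i x) (A v *m E j x)) (A_skew v (E j x) (E i x)) opprK.
    move: (bil _ _ _) (bil _ _ _) (bil _ _ _) (dirder _ _ _) => b1 b2 b3 d h.
    by rewrite -[b1 + b1]mulr2n -mulr_natl -h; ring.
  have E0 : \sum_a vol (w x) (fun j => if j == a then A v *m E j x else E j x) = 0.
    apply: (addIr (\sum_a vol (w x) (fun j => if j == a then Dv x v (E j) else E j x))).
    by rewrite -volD add0r; apply: Dv_vol.
  rewrite -[RHS]E0; apply: eq_bigr => i _; congr vol; apply/funext => j.
  by case: eqP => _; rewrite Ex.
have [U [oU Ux [J1 [J2 [J3 [_ tr JP]]]]]] := local_triple x.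
have [_ _ _ _ qE] := tr.
have cJ J : J = J1 \/ J = J2 \/ J = J3 -> J x *m A v = A v *m J x.
  move=> /JP [sJ QJ JJ Jw].
  (* The form w (A ., .) inherits the J-invariance of Dvol w. As w itself is J-invariant and
     nondegenerate, A commutes with J. *)
  have AJ u z : bil (w x) (A v *m (J x *m u)) (J x *m z) = bil (w x) (A v *m u) z.
    have [Y fY <-] := field_through x u; have [Z fZ <-] := field_through x z.
    apply: (mulfI two0); rewrite -nablaE // -(nabla_form_invariant v oU Ux sJ QJ JJ Jw fY fZ).
    exact (esym (nablaE v _ _ (sJ x Ux Y fY) (sJ x Ux Z fZ))).
  suff Ju (u : V) : J x *m A v *m u = A v *m J x *m u.
    apply/matrixP => i j; have /matrixP/(_ i 0) := Ju (delta_mx j 0).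
    by rewrite -!colE !mxE.
  apply/eqP; rewrite -subr_eq0; apply/eqP/(bil_nondegenerate (w_unit x)) => z.
  rewrite bilBl -!mulmxA (w_Q_skew (QJ x Ux)).
  rewrite -[in X in - X - _]AJ mulmxA -/(mulmx _ _).
  by rewrite mulmxA JJ // mulNmx mul1mx bilNr opprK subrr.
move=> K /qE [a [b [c ->]]].
rewrite !mulmxDl !mulmxDr -!scalemxAl -!scalemxAr !cJ; auto.
Qed.

End CanonicalDifference.

(** * Vanishing of the Oproiu torsion and the equivalence *)

Lemma bil0l (R : realType) (m : nat) (w : 'M[R]_m) z : bil w 0 z = 0.
Proof. by rewrite -(scale0r z) bilZl mul0r. Qed.

(** Each S u normalises q, so it splits into an element K u of q and a part commuting with q; the
    latter is the gl(n, H)-part in [X12_delta_normalizer]. *)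
Lemma oproiu_torsion_eq0 (R : realType) (n : nat) (q : set 'M[R]_(4 * n))
    (w J1 J2 J3 : 'M[R]_(4 * n)) (F : EHframe q w)
    (T : 'cV[R]_(4 * n) -> 'cV[R]_(4 * n) -> 'cV[R]_(4 * n))
    (S : 'cV[R]_(4 * n) -> 'M[R]_(4 * n)) :
  (0 < n)%N -> w \in unitmx -> quaternionic_triple q J1 J2 J3 ->
  (forall K, q K -> forall u v, bil w (K *m u) v = - bil w u (K *m v)) ->
  X12 F T -> (forall u J, J = J1 \/ J = J2 -> q (S u *m J - J *m S u)) ->
  (forall u v, T u v = S u *m v - S v *m u) ->
  forall u v, T u v = 0.
Proof.
move=> n_gt0 w_unit tr w_inv XT Sq TE u v.
have m_gt0 : (0 < 4 * n)%N by rewrite muln_gt0.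
have ex y : exists K, q K /\ forall L, q L -> L *m (S y - K) = (S y - K) *m L.
  by have [K qK cK] := normalizer_decomposition tr m_gt0 (Sq y); exists K.
have [K /all_and2 [qK cK]] := choice ex.
apply: (bil_nondegenerate w_unit) => z; move: u v z.
apply: (X12_delta_normalizer (al := fun y => S y - K y) n_gt0 XT qK).
  by move=> y; apply: (commute_qinv w_inv (cK y)).
by move=> y z; rewrite !subrK.
Qed.

(** Applying the skewness in v, z and the symmetry in u, v alternately, three times each, restores
    the order of the arguments with the sign -1. *)
Lemma sym_skew_eq0 (R : realType) (m : nat) (w : 'M[R]_m) (B : 'cV[R]_m -> 'M[R]_m) :
  w \in unitmx -> (forall u v z, bil w (B u *m v) z = - bil w (B u *m z) v) ->
  (forall u v : 'cV[R]_m, B u *m v = B v *m u) -> forall u v : 'cV[R]_m, B u *m v = 0.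
Proof.
move=> w_unit B_skew B_sym u v; apply: (bil_nondegenerate w_unit) => z.
have : bil w (B u *m v) z = - bil w (B u *m v) z.
  rewrite {1}B_skew {1}B_sym B_skew B_sym opprK B_skew; congr (- _).
  by rewrite B_sym.
by move=> /eqP; rewrite -addr_eq0 -mulr2n mulrn_eq0 /= => /eqP.
Qed.

Theorem theorem1p7 (R : realType) (n : nat) (hn : (1 < n)%N)
  (M : manifold R (4 * n)) (hM : connected [set: M])
  (Q : M -> set 'M[R]_(4 * n)) (w : M -> 'M[R]_(4 * n))
  (hQ : almost_quaternionic Q) (hw : scalar_2form Q w)
  (D : M -> 'cV[R]_(4 * n) -> (M -> 'cV[R]_(4 * n)) -> 'cV[R]_(4 * n))
  (hD : canonical_connection Q w D) :
  quaternionic Q /\ closed_form w <-> torsion_in (@X5 R n) Q w D.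
Proof.
have n_gt0 : (0 < n)%N by apply: ltnW.
have [cD [Dv [[cDv Dv_Q Dv_tor] Dv_vol D_def]]] := hD.
have w_sk x u v := w_skew hw x u v.
have w_inv x K (qK : Q x K) := w_Q_skew hQ hw qK.
have [_ _ w_unit _] := hw.
have D_tor x (A : 'cV[R]_(4 * n) -> 'M[R]_(4 * n)) Y Z :
    (forall v Y, field_at x Y -> D x v Y - Dv x v Y = A v *m Y x) ->
    field_at x Y -> field_at x Z ->
    torsion D Y Z x = torsion Dv Y Z x + delta A (Y x) (Z x).
  move=> AE fY fZ; rewrite /torsion /delta -!AE //.
  by move: (bracket Y Z x) => b; apply/matrixP => i j; rewrite !mxE; ring.
split=> [[[D' [cD' D'_Q D'_tor]] w_closed] x F|D_X5].
  have [U [oU Ux [J1 [J2 [J3 [_ tr JP]]]]]] := local_triple hQ hw x.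
  have [T XT TE] := Dv_tor x F.
  have [S [_ SE]] := connection_difference x cDv cD'.
  (* D' has no torsion, so the torsion of Dvol is delta S with S = Dvol - D'. *)
  have T0 : forall u v, T u v = 0.
    apply: (oproiu_torsion_eq0 (S := S) n_gt0 (w_unit x) tr (@w_inv x) XT).
      have Sq J : J = J1 \/ J = J2 \/ J = J3 -> forall v, Q x (S v *m J x - J x *m S v).
        move=> /JP [sJ QJ _ _].
        exact (difference_normalizes Dv_Q D'_Q (triple_subr tr) SE oU Ux sJ QJ).
      by move=> v _ [->|->]; apply: Sq; [left|right; left].
    move=> u v; have [X fX <-] := field_through x u; have [Y fY <-] := field_through x v.
    rewrite -(TE X Y fX fY) -[LHS]subr0 -(D'_tor x X Y fX fY) -(SE _ Y fY) -(SE _ X fX).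
    rewrite /torsion; move: (bracket X Y x) => b.
    by apply/matrixP => i j; rewrite !mxE; ring.
  have [A [A_lin AE nablaE A_S20]] := canonical_difference hQ hw cD cDv Dv_Q Dv_vol D_def x.
  exists (delta A); last first.
    move=> Y Z fY fZ.
    by rewrite (D_tor x A Y Z AE fY fZ) (TE Y Z fY fZ) T0 add0r.
  exists A => //; apply: S30EH_cyclic; [exact (@w_inv x)|exact A_lin|exact A_S20|].
  move=> u v z; have [X fX <-] := field_through x u.
  have [Y fY <-] := field_through x v; have [Z fZ <-] := field_through x z.
  (* Without torsion, dw is the cyclic sum of Dvol w, that is, twice that of w (A u v, z). *)
  have := w_closed x X Y Z fX fY fZ.
  rewrite (ext_der_nabla Dv X Y Z x w_sk) (TE X Y fX fY) (TE Y Z fY fZ) (TE Z X fZ fX) !T0.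
  rewrite !bil0l !addr0 (nablaE _ Y Z fY fZ) (nablaE _ Z X fZ fX) (nablaE _ X Y fX fY).
  by rewrite -!mulrDr => /eqP; rewrite mulf_eq0 pnatr_eq0 /= => /eqP.
have key x : exists A : 'cV[R]_(4 * n) -> 'M[R]_(4 * n),
    [/\ forall v Y Z, field_at x Y -> field_at x Z ->
        nabla_form Dv w x v Y Z = 2 * bil (w x) (A v *m Y x) (Z x),
      forall u v z, bil (w x) (A u *m v) z + bil (w x) (A v *m z) u +
        bil (w x) (A z *m u) v = 0 &
      forall X Y, field_at x X -> field_at x Y -> torsion Dv X Y x = 0].
  have [U [oU Ux [J1 [J2 [J3 [_ tr JP]]]]]] := local_triple hQ hw x.
  have [F] := frame_at hQ hw x.
  have [T XT TE] := Dv_tor x F.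
  have [T5 [A' A'_S30 T5E] DE] := D_X5 x F.
  have [A [A_lin AE nablaE A_S20]] := canonical_difference hQ hw cD cDv Dv_Q Dv_vol D_def x.
  have [A'_S20 _] := A'_S30.
  (* The torsion of D is delta A' by type X_5 and T + delta A by construction. B commutes with q, so
     it normalises q trivially and T = delta B vanishes; then B u v is symmetric in u, v. *)
  pose B u := A' u - A u.
  have TB u v : T u v = B u *m v - B v *m u.
    have [X fX <-] := field_through x u; have [Y fY <-] := field_through x v.
    have := D_tor x A X Y AE fX fY; rewrite (DE X Y fX fY) (TE X Y fX fY) T5E /delta /B.
    rewrite !mulmxBl; move: (A' _ *m _) (A' _ *m _) (A _ *m _) (A _ *m _) (T _ _) => a b c d e h.
    apply/matrixP => i j; have /matrixP/(_ i j) := h; rewrite !mxE => hij.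
    have -> : e i j = b i j - a i j - (d i j - c i j) by rewrite hij addrK.
    by ring.
  have T0 : forall u v, T u v = 0.
    apply: (oproiu_torsion_eq0 (S := B) n_gt0 (w_unit x) tr (@w_inv x) XT) => // v J JJ.
    have QJ : Q x J by case: JJ => ->; [exact (triple_in1 tr)|exact (triple_in2 tr)].
    have [_ cA _] := A_S20 v; have [_ cA' _] := A'_S20 v.
    by rewrite mulmxBl mulmxBr cA // cA' // subrr; apply: (triple0 tr).
  have B0 : forall u v : 'cV[R]_(4 * n), B u *m v = 0.
    apply: (sym_skew_eq0 (w_unit x)) => [u v z|u v].
      have [_ _ sA] := A_S20 u; have [_ _ sA'] := A'_S20 u.
      by rewrite /B !mulmxBl !bilBl sA sA'; ring.
    by apply/eqP; rewrite -subr_eq0 -TB T0.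
  have AA' u (v : 'cV[R]_(4 * n)) : A u *m v = A' u *m v.
    by apply/esym/eqP; rewrite -subr_eq0 -mulmxBl; apply/eqP/B0.
  exists A; split; first exact nablaE.
    by move=> u v z; rewrite !AA'; apply: (cyclic_S30EH A'_S30).
  by move=> X Y fX fY; rewrite (TE X Y fX fY) T0.
split.
  (* The volume-preserving Oproiu connection itself is the torsion-free one. *)
  exists Dv; split; [exact cDv|exact Dv_Q|move=> x X Y fX fY].
  by have [A [_ _ tor0]] := key x; apply: tor0.
move=> x X Y Z fX fY fZ; have [A [nablaE A_cyc tor0]] := key x.
rewrite (ext_der_nabla Dv X Y Z x w_sk) (tor0 X Y fX fY) (tor0 Y Z fY fZ) (tor0 Z X fZ fX).
rewrite !bil0l !addr0 (nablaE _ Y Z fY fZ) (nablaE _ Z X fZ fX) (nablaE _ X Y fX fY).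
by rewrite -!mulrDr A_cyc mulr0.
Qed.
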